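(* Let $\mathcal{C}$ be a triangulated category endowed with a weight structure $w$, and let $\mathcal{A}:\underline{Hw}\to A$ be an additive functor, where $A$ is any abelian category. Choose a weight complex $t(M)=(M^j)$ for each $M\in\mathrm{Obj}\,\mathcal{C}$, and denote by $H(M)=H^{\mathcal{A}}(M)$ the zeroth homology of the complex $(\mathcal{A}(M^j))_j$ (i.e., its homology at $\mathcal{A}(M^0)$). Then $H(-)$ yields a homological functor $\mathcal{C}\to A$ that does not depend on the choices of weight complexes. Moreover, the assignment $\mathcal{A}\mapsto H^{\mathcal{A}}$ is natural in $\mathcal{A}$.
   Context: Weight structures: a pair $(\mathcal{C}_{w\le 0},\mathcal{C}_{w\ge 0})$ of classes of objects such that: (i) both are closed under retracts in $\mathcal{C}$; (ii) $\mathcal{C}_{w\le 0}\subset \mathcal{C}_{w\le 0}[1]$ and $\mathcal{C}_{w\ge 0}[1]\subset \mathcal{C}_{w\ge 0}$; (iii) $\mathcal{C}(X,Y)=0$ for $X\in\mathcal{C}_{w\le 0}$, $Y\in \mathcal{C}_{w\ge 0}[1]$; (iv) every object $M$ fits in a distinguished triangle $LM\to M\to RM\to LM[1]$ with $LM\in\mathcal{C}_{w\le 0}$, $RM\in \mathcal{C}_{w\ge 0}[1]$. Put $\mathcal{C}_{w\le i}=\mathcal{C}_{w\le 0}[i]$, $\mathcal{C}_{w\ge i}=\mathcal{C}_{w\ge 0}[i]$. The heart $\underline{Hw}$ is the full subcategory on $\mathcal{C}_{w\le 0}\cap\mathcal{C}_{w\ge 0}$. Weight complexes: for $M\in\mathrm{Obj}\,\mathcal{C}$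 choose for all $i\in\mathbb{Z}$ distinguished triangles $w_{\le i}M\xrightarrow{h_i}M\to w_{\ge i+1}M\to$ with $w_{\le i}M\in\mathcal{C}_{w\le i}$, $w_{\ge i+1}M\in\mathcal{C}_{w\ge i+1}$. There are unique $j_i:w_{\le i}M\to w_{\le i+1}M$ with $h_{i+1}\circ j_i=h_i$; choose distinguished triangles $w_{\le i-1}M\xrightarrow{j_{i-1}}w_{\le i}M\to M_i\to w_{\le i-1}M[1]$. Put $M^p=M_{-p}[p]$; these objects belong to $\underline{Hw}$. The differential $M^p\to M^{p+1}$ is the shift by $[p]$ of the composition $M_{-p}\to w_{\le -p-1}M[1]\to M_{-p-1}[1]$. Any complex $(M^p)$ obtained this way is called (a choice of) a weight complex of $M$ (complexes are cohomological). Any morphism $g:M\to M'$ in $\mathcal{C}$ extends to a morphism of these data, hence to a morphism of the chosen weight complexes; this is how $H$ is defined on morphisms. *)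

(* Defs.v *)
From HB Require Import structures.
From mathcomp Require Import all_boot order ssralg ssrnum ssrint.
From mathcomp Require Import boolp.

Set Implicit Arguments.
Unset Strict Implicit.
Unset Printing Implicit Defensive.
Import Order.TTheory GRing.Theory Num.Theory.
Local Open Scope ring_scope.

(* Hom-groups are [zmodType]s; their choice structure is no restriction in the
   presence of the axioms of boolp. *)
Record preadditive := Preadditive {
  Obj :> Type;
  Hom : Obj -> Obj -> zmodType;
  idm : forall X, Hom X X;
  mcomp : forall X Y Z, Hom Y Z -> Hom X Y -> Hom X Z;
  mcomp_idl : forall X Y (f : Hom X Y), mcomp (idm Y) f = f;
  mcomp_idr : forall X Y (f : Hom X Y), mcomp f (idm X) = f;
  mcompA : forall X Y Z T (h : Hom Z T) (g : Hom Y Z) (f : Hom X Y),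
    mcomp h (mcomp g f) = mcomp (mcomp h g) f;
  mcompDl : forall X Y Z (g g' : Hom Y Z) (f : Hom X Y),
    mcomp (g + g') f = mcomp g f + mcomp g' f;
  mcompDr : forall X Y Z (g : Hom Y Z) (f f' : Hom X Y),
    mcomp g (f + f') = mcomp g f + mcomp g f' }.

Arguments Hom {p} X Y.
Arguments idm {p} X.
Notation "g \oc f" := (mcomp g f)
  (at level 40, left associativity, format "g  \oc  f").

Definition is_iso (C : preadditive) (X Y : C) (f : Hom X Y) : Prop :=
  exists g : Hom Y X, g \oc f = idm X /\ f \oc g = idm Y.

Definition isomorphic (C : preadditive) (X Y : C) : Prop :=
  exists f : Hom X Y, is_iso f.

Definition is_retract (C : preadditive) (X Y : C) : Prop :=
  exists (i : Hom X Y) (r : Hom Y X), r \oc i = idm X.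

Definition is_mono (C : preadditive) (X Y : C) (f : Hom X Y) : Prop :=
  forall W (u v : Hom W X), f \oc u = f \oc v -> u = v.

Definition is_epi (C : preadditive) (X Y : C) (f : Hom X Y) : Prop :=
  forall W (u v : Hom Y W), u \oc f = v \oc f -> u = v.

Definition is_zero_obj (C : preadditive) (Z : C) : Prop :=
  (forall X (f g : Hom X Z), f = g) /\ (forall X (f g : Hom Z X), f = g).

Definition is_biproduct (C : preadditive) (X Y B : C)
    (i1 : Hom X B) (i2 : Hom Y B) (p1 : Hom B X) (p2 : Hom B Y) : Prop :=
  [/\ p1 \oc i1 = idm X, p2 \oc i2 = idm Y, p2 \oc i1 = 0, p1 \oc i2 = 0
    & i1 \oc p1 + i2 \oc p2 = idm B].

Record additive_category := AdditiveCategory {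
  add_pre :> preadditive;
  zero_exists : exists Z : add_pre, is_zero_obj Z;
  biproduct_exists : forall X Y : add_pre,
    exists (B : add_pre) (i1 : Hom X B) (i2 : Hom Y B)
      (p1 : Hom B X) (p2 : Hom B Y), is_biproduct i1 i2 p1 p2 }.

Definition is_kernel (C : preadditive) (X Y K : C) (f : Hom X Y)
    (k : Hom K X) : Prop :=
  f \oc k = 0 /\
  forall W (g : Hom W X), f \oc g = 0 -> exists! u : Hom W K, k \oc u = g.

Definition is_cokernel (C : preadditive) (X Y Q : C) (f : Hom X Y)
    (q : Hom Y Q) : Prop :=
  q \oc f = 0 /\
  forall W (g : Hom Y W), g \oc f = 0 -> exists! u : Hom Q W, u \oc q = g.

Record abelian := Abelian {
  ab_add :> additive_category;
  kernel_exists : forall (X Y : ab_add) (f : Hom X Y),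
    exists (K : ab_add) (k : Hom K X), is_kernel f k;
  cokernel_exists : forall (X Y : ab_add) (f : Hom X Y),
    exists (Q : ab_add) (q : Hom Y Q), is_cokernel f q;
  mono_is_kernel : forall (X Y : ab_add) (f : Hom X Y), is_mono f ->
    exists (Z : ab_add) (g : Hom Y Z), is_kernel g f;
  epi_is_cokernel : forall (X Y : ab_add) (f : Hom X Y), is_epi f ->
    exists (W : ab_add) (g : Hom W X), is_cokernel g f }.

Definition full_subcategory (C : preadditive) (P : C -> Prop) : preadditive :=
  @Preadditive {X : C | P X}
    (fun X Y => Hom (sval X) (sval Y))
    (fun X => idm (sval X))
    (fun X Y Z g f => mcomp g f)
    (fun X Y f => mcomp_idl f)
    (fun X Y f => mcomp_idr f)
    (fun X Y Z T h g f => mcompA h g f)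
    (fun X Y Z g g' f => mcompDl g g' f)
    (fun X Y Z g f f' => mcompDr g f f').

Section PreadditiveTheory.
Variable C : preadditive.
Implicit Types X Y Z W : C.

Lemma mcomp0r X Y Z (g : Hom Y Z) : g \oc (0 : Hom X Y) = 0.
Proof. by apply: (addrI (g \oc 0)); rewrite -mcompDr !addr0. Qed.

Lemma mcomp0l X Y Z (f : Hom X Y) : (0 : Hom Y Z) \oc f = 0.
Proof. by apply: (addrI (0 \oc f)); rewrite -mcompDl !addr0. Qed.

Lemma mcompNr X Y Z (g : Hom Y Z) (f : Hom X Y) : g \oc (- f) = - (g \oc f).
Proof. by apply: (addrI (g \oc f)); rewrite -mcompDr !subrr mcomp0r. Qed.

Lemma mcompNl X Y Z (g : Hom Y Z) (f : Hom X Y) : (- g) \oc f = - (g \oc f).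
Proof. by apply: (addrI (g \oc f)); rewrite -mcompDl !subrr mcomp0l. Qed.

Lemma mcompBr X Y Z (g : Hom Y Z) (f f' : Hom X Y) :
  g \oc (f - f') = g \oc f - g \oc f'.
Proof. by rewrite mcompDr mcompNr. Qed.

Lemma mcompBl X Y Z (g g' : Hom Y Z) (f : Hom X Y) :
  (g - g') \oc f = g \oc f - g' \oc f.
Proof. by rewrite mcompDl mcompNl. Qed.

Lemma isomorphic_sym X Y : isomorphic X Y -> isomorphic Y X.
Proof. by case=> f [g [gf fg]]; exists g, f. Qed.

Lemma isomorphic_trans Y X Z :
  isomorphic X Y -> isomorphic Y Z -> isomorphic X Z.
Proof.
case=> f [g [gf fg]] [f' [g' [gf' fg']]].
exists (f' \oc f), (g \oc g'); split.
  by rewrite -mcompA [g' \oc _]mcompA gf' mcomp_idl.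
by rewrite -mcompA [f \oc _]mcompA fg mcomp_idl.
Qed.

Lemma isomorphic_retract X Y : isomorphic X Y -> is_retract X Y.
Proof. by case=> f [g [gf _]]; exists f, g. Qed.

End PreadditiveTheory.

Definition is_functor (C D : preadditive) (fo : C -> D)
    (fm : forall X Y : C, Hom X Y -> Hom (fo X) (fo Y)) : Prop :=
  (forall X, fm X X (idm X) = idm (fo X)) /\
  (forall X Y Z (g : Hom Y Z) (f : Hom X Y),
    fm X Z (g \oc f) = fm Y Z g \oc fm X Y f).

Definition is_additive (C D : preadditive) (fo : C -> D)
    (fm : forall X Y : C, Hom X Y -> Hom (fo X) (fo Y)) : Prop :=
  forall X Y (f g : Hom X Y), fm X Y (f + g) = fm X Y f + fm X Y g.

Definition is_natural (C D : preadditive)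
    (fo : C -> D) (fm : forall X Y : C, Hom X Y -> Hom (fo X) (fo Y))
    (go : C -> D) (gm : forall X Y : C, Hom X Y -> Hom (go X) (go Y))
    (phi : forall X, Hom (fo X) (go X)) : Prop :=
  forall X Y (f : Hom X Y), phi Y \oc fm X Y f = gm X Y f \oc phi X.

Record additive_functor (C D : preadditive) := AdditiveFunctor {
  fobj :> C -> D;
  fmap : forall X Y : C, Hom X Y -> Hom (fobj X) (fobj Y);
  fmap_functor : is_functor fmap;
  fmap_additive : is_additive fmap }.
Arguments fmap {C D} a {X Y} f.

Record nat_trans (C D : preadditive) (F G : additive_functor C D) := NatTrans {
  nt :> forall X : C, Hom (F X) (G X);
  nt_natural : is_natural (@fmap _ _ F) (@fmap _ _ G) nt }.

Section FunctorTheory.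
Variables (C D : preadditive) (F : additive_functor C D).
Implicit Types X Y Z : C.

Lemma fmap1 X : fmap F (idm X) = idm (F X).
Proof. exact: (fmap_functor F).1. Qed.

Lemma fmapM X Y Z (g : Hom Y Z) (f : Hom X Y) :
  fmap F (g \oc f) = fmap F g \oc fmap F f.
Proof. exact: (fmap_functor F).2. Qed.

Lemma fmapD X Y (f g : Hom X Y) : fmap F (f + g) = fmap F f + fmap F g.
Proof. exact: fmap_additive. Qed.

Lemma fmap0 X Y : fmap F (0 : Hom X Y) = 0.
Proof. by apply: (addrI (fmap F 0)); rewrite -fmapD !addr0. Qed.

Lemma fmap_iso X Y : isomorphic X Y -> isomorphic (F X) (F Y).
Proof.
by case=> f [g [gf fg]]; exists (fmap F f), (fmap F g);
  rewrite -!fmapM gf fg !fmap1.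
Qed.

End FunctorTheory.

Lemma id_nat_natural (C D : preadditive) (F : additive_functor C D) :
  is_natural (@fmap _ _ F) (@fmap _ _ F) (fun X => idm (F X)).
Proof. by move=> X Y f; rewrite mcomp_idl mcomp_idr. Qed.

Definition id_nat (C D : preadditive) (F : additive_functor C D) :
  nat_trans F F := NatTrans (id_nat_natural F).

Lemma comp_nat_natural (C D : preadditive) (F G H : additive_functor C D)
    (psi : nat_trans G H) (phi : nat_trans F G) :
  is_natural (@fmap _ _ F) (@fmap _ _ H) (fun X => psi X \oc phi X).
Proof.
by move=> X Y f; rewrite -mcompA nt_natural !mcompA nt_natural.
Qed.

Definition comp_nat (C D : preadditive) (F G H : additive_functor C D)
    (psi : nat_trans G H) (phi : nat_trans F G) : nat_trans F H :=
  NatTrans (comp_nat_natural psi phi).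

Lemma id_functor_subproof (C : preadditive) :
  is_functor (fun (X Y : C) (f : Hom X Y) => f).
Proof. by []. Qed.

Definition id_functor (C : preadditive) : additive_functor C C :=
  @AdditiveFunctor C C (fun X => X) (fun X Y f => f)
    (id_functor_subproof C) (fun X Y f g => erefl).

Lemma comp_functor_subproof (C D E : preadditive)
    (G : additive_functor D E) (F : additive_functor C D) :
  is_functor (fun (X Y : C) (f : Hom X Y) => fmap G (fmap F f)) /\
  is_additive (fun (X Y : C) (f : Hom X Y) => fmap G (fmap F f)).
Proof.
split; first by split=> *; rewrite ?fmap1 ?fmapM.
by move=> *; rewrite !fmapD.
Qed.

Definition comp_functor (C D E : preadditive)
    (G : additive_functor D E) (F : additive_functor C D) :
    additive_functor C E :=
  @AdditiveFunctor C E (fun X => G (F X)) (fun X Y f => fmap G (fmap F f))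
    (comp_functor_subproof G F).1 (comp_functor_subproof G F).2.

Fixpoint iter_functor (C : preadditive) (F : additive_functor C C) (n : nat) :
    additive_functor C C :=
  if n is m.+1 then comp_functor (iter_functor F m) F else id_functor C.

(* The translation [1] is an additive auto-equivalence [sh] with a chosen
   quasi-inverse [shV]; no equality between objects is imposed. *)
Record shifted_category := ShiftedCategory {
  shc_add :> additive_category;
  sh : additive_functor shc_add shc_add;
  shV : additive_functor shc_add shc_add;
  sh_unit : nat_trans (comp_functor shV sh) (id_functor shc_add);
  sh_counit : nat_trans (comp_functor sh shV) (id_functor shc_add);
  sh_unit_iso : forall X, is_iso (sh_unit X);
  sh_counit_iso : forall X, is_iso (sh_counit X) }.

Arguments sh {s}.
Arguments shV {s}.
Arguments sh_unit {s}.
Arguments sh_counit {s}.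

Definition is_tri_mor (C : shifted_category)
    (X Y Z : C) (f : Hom X Y) (g : Hom Y Z) (h : Hom Z (sh X))
    (X' Y' Z' : C) (f' : Hom X' Y') (g' : Hom Y' Z') (h' : Hom Z' (sh X'))
    (a : Hom X X') (b : Hom Y Y') (c : Hom Z Z') : Prop :=
  [/\ b \oc f = f' \oc a, c \oc g = g' \oc b & fmap sh a \oc h = h' \oc c].

Record triangulated := Triangulated {
  tr_sh :> shifted_category;
  dist : forall X Y Z : tr_sh,
    Hom X Y -> Hom Y Z -> Hom Z (sh X) -> Prop;
  dist_iso : forall (X Y Z : tr_sh) (f : Hom X Y) (g : Hom Y Z)
      (h : Hom Z (sh X)) (X' Y' Z' : tr_sh) (f' : Hom X' Y') (g' : Hom Y' Z')
      (h' : Hom Z' (sh X')) (a : Hom X X') (b : Hom Y Y') (c : Hom Z Z'),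
    is_tri_mor f g h f' g' h' a b c -> is_iso a -> is_iso b -> is_iso c ->
    dist f g h -> dist f' g' h';
  dist_id : forall X Z : tr_sh, is_zero_obj Z ->
    dist (idm X) (0 : Hom X Z) (0 : Hom Z (sh X));
  dist_cone : forall (X Y : tr_sh) (f : Hom X Y),
    exists (Z : tr_sh) (g : Hom Y Z) (h : Hom Z (sh X)), dist f g h;
  dist_rotate : forall (X Y Z : tr_sh) (f : Hom X Y) (g : Hom Y Z)
      (h : Hom Z (sh X)), dist f g h <-> dist g h (- fmap sh f);
  dist_fill : forall (X Y Z : tr_sh) (f : Hom X Y) (g : Hom Y Z)
      (h : Hom Z (sh X)) (X' Y' Z' : tr_sh) (f' : Hom X' Y') (g' : Hom Y' Z')
      (h' : Hom Z' (sh X')) (a : Hom X X') (b : Hom Y Y'),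
    dist f g h -> dist f' g' h' -> b \oc f = f' \oc a ->
    exists c : Hom Z Z', is_tri_mor f g h f' g' h' a b c;
  dist_octahedral : forall (X Y Z U V W : tr_sh)
      (f : Hom X Y) (f1 : Hom Y U) (f2 : Hom U (sh X))
      (g : Hom Y Z) (g1 : Hom Z V) (g2 : Hom V (sh Y))
      (k1 : Hom Z W) (k2 : Hom W (sh X)),
    dist f f1 f2 -> dist g g1 g2 -> dist (g \oc f) k1 k2 ->
    exists (u : Hom U W) (v : Hom W V),
      [/\ dist u v (fmap sh f1 \oc g2),
          u \oc f1 = k1 \oc g, k2 \oc u = f2,
          v \oc k1 = g1 & g2 \oc v = fmap sh f \oc k2] }.

Definition shift (C : shifted_category) (i : int) : additive_functor C C :=
  match i with
  | Posz n => iter_functor sh n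
  | Negz n => iter_functor shV n.+1
  end.
Arguments shift {C} i.

(* The identity X i -> X j when i = j is not a conversion. *)
Definition transport (C : preadditive) (X : int -> C) (i j : int) (e : i = j) :
    Hom (X i) (X j) :=
  match e in _ = k return Hom (X i) (X k) with erefl => idm (X i) end.

Lemma shift_succ_pos (n : nat) : Posz n.+1 = Posz n + 1.
Proof. by rewrite -PoszD addn1. Qed.

Lemma shift_succ_neg (n : nat) : - Posz n = Negz n + 1.
Proof. by rewrite NegzE -addn1 PoszD opprD addrNK. Qed.

Definition shift_neg (C : shifted_category) (n : nat) (X : C) :
    Hom (iter_functor shV n X) (shift (- Posz n) X) :=
  match n return Hom (iter_functor shV n X) (shift (- Posz n) X) with
  | 0%N => idm X
  | m.+1 => idm (iter_functor shV m.+1 X)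
  end.

(* The identification X[1][p] = X[p+1]; for p < 0 it cancels one [-1] against
   the inner [1] by means of [sh_unit]. *)
Definition shift_succ (C : shifted_category) (p : int) (X : C) :
    Hom (shift p (sh X)) (shift (p + 1) X) :=
  match p return Hom (shift p (sh X)) (shift (p + 1) X) with
  | Posz n => transport (fun i => shift i X) (shift_succ_pos n)
  | Negz n => transport (fun i => shift i X) (shift_succ_neg n) \oc
      (shift_neg n X \oc fmap (iter_functor shV n) (sh_unit X))
  end.

Lemma transport_natural (C : preadditive) (X Y : int -> C)
    (f : forall i, Hom (X i) (Y i)) (i j : int) (e : i = j) :
  f j \oc transport X e = transport Y e \oc f i.
Proof. by case: j / e; rewrite mcomp_idl mcomp_idr. Qed.

Lemma shift_neg_natural (C : shifted_category) (n : nat) (X Y : C)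
    (f : Hom X Y) :
  shift_neg n Y \oc fmap (iter_functor shV n) f =
  fmap (shift (- Posz n)) f \oc shift_neg n X.
Proof. by case: n => [|n]; rewrite mcomp_idl mcomp_idr. Qed.

Lemma shift_succ_natural (C : shifted_category) (p : int) (X Y : C)
    (f : Hom X Y) :
  shift_succ p Y \oc fmap (shift p) (fmap sh f) =
  fmap (shift (p + 1)) f \oc shift_succ p X.
Proof.
case: p => n.
  symmetry; exact: (@transport_natural C (fun i => shift i X)
    (fun i => shift i Y) (fun i => fmap (shift i) f) _ _ (shift_succ_pos n)).
rewrite /shift_succ [RHS]mcompA.
rewrite (@transport_natural C (fun i => shift i X) (fun i => shift i Y)
  (fun i => fmap (shift i) f) _ _ (shift_succ_neg n)).
rewrite -!mcompA; congr (_ \oc _).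
rewrite [RHS]mcompA -shift_neg_natural -!mcompA; congr (_ \oc _).
exact: etrans (esym (fmapM (iter_functor shV n) (sh_unit Y) _))
  (etrans (congr1 _ (nt_natural sh_unit f)) (fmapM _ f (sh_unit X))).
Qed.

(* C_{w<=i} = C_{w<=0}[i], as a class of objects closed under isomorphism. *)
Definition shift_class (C : shifted_category) (P : C -> Prop) (i : int)
    (X : C) : Prop :=
  exists Y, P Y /\ isomorphic X (shift i Y).

Record weight_structure (C : triangulated) := WeightStructure {
  w_le0 : C -> Prop;
  w_ge0 : C -> Prop;
  w_le0_retract : forall X Y, is_retract X Y -> w_le0 Y -> w_le0 X;
  w_ge0_retract : forall X Y, is_retract X Y -> w_ge0 Y -> w_ge0 X;
  w_le0_shift : forall X, w_le0 X -> shift_class w_le0 1 X;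
  w_ge0_shift : forall X, shift_class w_ge0 1 X -> w_ge0 X;
  w_orthogonal : forall X Y, w_le0 X -> shift_class w_ge0 1 Y ->
    forall f : Hom X Y, f = 0;
  w_decomposition : forall M, exists (L R : C) (f : Hom L M) (g : Hom M R)
    (h : Hom R (sh L)), [/\ w_le0 L, shift_class w_ge0 1 R & dist f g h] }.

Definition w_le (C : triangulated) (w : weight_structure C) (i : int) :
  C -> Prop := shift_class (w_le0 w) i.

Definition w_ge (C : triangulated) (w : weight_structure C) (i : int) :
  C -> Prop := shift_class (w_ge0 w) i.

Definition in_heart (C : triangulated) (w : weight_structure C) (X : C) : Prop :=
  w_le0 w X /\ w_ge0 w X.

Definition heart (C : triangulated) (w : weight_structure C) : preadditive :=
  full_subcategory (in_heart w).

(* The data chosen to build a weight complex of M.  [wj i] is the morphism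
   j_{i-1} : w_{<=i-1}M -> w_{<=i}M and [wM i] is its cone M_i. *)
Record weight_data (C : triangulated) (w : weight_structure C) (M : C) :=
  WeightData {
  wle : int -> C;
  wge : int -> C;
  wh : forall i, Hom (wle i) M;
  wr : forall i, Hom M (wge (i + 1));
  wd : forall i, Hom (wge (i + 1)) (sh (wle i));
  wle_le : forall i, w_le w i (wle i);
  wge_ge : forall i, w_ge w i (wge i);
  w_dist : forall i, dist (wh i) (wr i) (wd i);
  wj : forall i, Hom (wle (i - 1)) (wle i);
  wh_wj : forall i, wh i \oc wj i = wh (i - 1);
  wM : int -> C;
  wa : forall i, Hom (wle i) (wM i);
  wb : forall i, Hom (wM i) (sh (wle (i - 1)));
  wM_dist : forall i, dist (wj i) (wa i) (wb i) }.

(* An extension of g : M -> M' to the chosen data. *)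
Record weight_data_mor (C : triangulated) (w : weight_structure C) (M M' : C)
    (g : Hom M M') (D : weight_data w M) (D' : weight_data w M') :=
  WeightDataMor {
  ml : forall i, Hom (wle D i) (wle D' i);
  mr : forall i, Hom (wge D (i + 1)) (wge D' (i + 1));
  mM : forall i, Hom (wM D i) (wM D' i);
  ml_mr_tri : forall i, is_tri_mor (wh D i) (wr D i) (wd D i)
    (wh D' i) (wr D' i) (wd D' i) (ml i) g (mr i);
  mM_tri : forall i, is_tri_mor (wj D i) (wa D i) (wb D i)
    (wj D' i) (wa D' i) (wb D' i) (ml (i - 1)) (ml i) (mM i) }.

Section TriangulatedTheory.
Variable C : triangulated.
Implicit Types (X Y Z T M W : C) (i : int).

Lemma shVsh_iso X : isomorphic (shV (sh X)) X.
Proof. by exists (sh_unit X); exact: sh_unit_iso. Qed.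

Lemma shshV_iso X : isomorphic (sh (shV X)) X.
Proof. by exists (sh_counit X); exact: sh_counit_iso. Qed.

Lemma sh_faithful X Y (f g : Hom X Y) : fmap sh f = fmap sh g -> f = g.
Proof.
move=> e; have [v [_ uv]] := sh_unit_iso X.
rewrite -[f]mcomp_idr -[g]mcomp_idr -uv !mcompA.
rewrite -!(nt_natural (sh_unit : nat_trans _ (id_functor C))).
by rewrite /= e.
Qed.

Lemma shV_faithful X Y (f g : Hom X Y) : fmap shV f = fmap shV g -> f = g.
Proof.
move=> e; have [v [_ uv]] := sh_counit_iso X.
rewrite -[f]mcomp_idr -[g]mcomp_idr -uv !mcompA.
rewrite -!(nt_natural (sh_counit : nat_trans _ (id_functor C))).
by rewrite /= e.
Qed.

Lemma sh_full X Y (u : Hom (sh X) (sh Y)) : exists f, fmap sh f = u.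
Proof.
have [v [vu uv]] := sh_unit_iso X.
have [v' [vu' uv']] := sh_unit_iso Y.
exists (sh_unit Y \oc (fmap shV u \oc v)).
apply: shV_faithful; set f := (sh_unit Y \oc _).
have := nt_natural (sh_unit : nat_trans _ (id_functor C)) f.
rewrite /= => e.
rewrite -[LHS]mcomp_idl -vu' -mcompA e /f.
by rewrite !mcompA vu' mcomp_idl -mcompA vu mcomp_idr.
Qed.

Lemma shV_full X Y (u : Hom (shV X) (shV Y)) : exists f, fmap shV f = u.
Proof.
have [v [vu uv]] := sh_counit_iso X.
have [v' [vu' uv']] := sh_counit_iso Y.
exists (sh_counit Y \oc (fmap sh u \oc v)).
apply: sh_faithful; set f := (sh_counit Y \oc _).
have := nt_natural (sh_counit : nat_trans _ (id_functor C)) f.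
rewrite /= => e.
rewrite -[LHS]mcomp_idl -vu' -mcompA e /f.
by rewrite !mcompA vu' mcomp_idl -mcompA vu mcomp_idr.
Qed.

Lemma iter_faithful (F : additive_functor C C) n :
  (forall X Y (f g : Hom X Y), fmap F f = fmap F g -> f = g) ->
  forall X Y (f g : Hom X Y),
  fmap (iter_functor F n) f = fmap (iter_functor F n) g -> f = g.
Proof. by move=> FF; elim: n => [//|n IH] X Y f g /= /IH /FF. Qed.

Lemma iter_full (F : additive_functor C C) n :
  (forall X Y (u : Hom (F X) (F Y)), exists f, fmap F f = u) ->
  forall X Y (u : Hom (iter_functor F n X) (iter_functor F n Y)),
  exists f, fmap (iter_functor F n) f = u.
Proof.
move=> FF; elim: n => [|n IH] X Y u; first by exists u.
have [v <-] := IH _ _ u; have [w <-] := FF _ _ v; by exists w.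
Qed.

Lemma shift_faithful i X Y (f g : Hom X Y) :
  fmap (shift i) f = fmap (shift i) g -> f = g.
Proof.
case: i => n; apply: iter_faithful => ????; [exact: sh_faithful|].
exact: shV_faithful.
Qed.

Lemma shift_full i X Y (u : Hom (shift i X) (shift i Y)) :
  exists f, fmap (shift i) f = u.
Proof.
case: i u => n; apply: iter_full => ??; [exact: sh_full|exact: shV_full].
Qed.

Lemma iter_functorSr (F : additive_functor C C) n X :
  iter_functor F n (F X) = F (iter_functor F n X).
Proof. by elim: n X => [//|n IH] X /=; rewrite IH. Qed.

Lemma iter_cancel (F G : additive_functor C C) :
  (forall X, isomorphic (G (F X)) X) ->
  forall n X, isomorphic (iter_functor G n (iter_functor F n X)) X.
Proof.
move=> GF; elim=> [|n IH] X; first by exists (idm X), (idm X);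
  rewrite !mcomp_idl.
apply: isomorphic_trans (IH X); rewrite /= (iter_functorSr F).
exact: (fmap_iso (iter_functor G n) (GF _)).
Qed.

Lemma isomorphic_refl X : isomorphic X X.
Proof. by exists (idm X), (idm X); rewrite !mcomp_idl. Qed.

Lemma shift_cancel i X : isomorphic (shift (- i) (shift i X)) X.
Proof.
case: i => [[|n]|n]; first exact: isomorphic_refl.
  exact/iter_cancel/shVsh_iso.
exact/iter_cancel/shshV_iso.
Qed.

Lemma shift_cancelV i X : isomorphic (shift i (shift (- i) X)) X.
Proof. by have := shift_cancel (- i) X; rewrite opprK. Qed.

Lemma shift_succ_isomorphic i X : isomorphic (shift i (sh X)) (shift (i + 1) X).
Proof.
case: i => n.
  by rewrite -shift_succ_pos; exact: isomorphic_refl.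
rewrite -shift_succ_neg.
have -> : shift (- Posz n) X = iter_functor shV n X by case: n.
exact/(fmap_iso (iter_functor shV n))/shVsh_iso.
Qed.

Lemma sh_shift_isomorphic i X : isomorphic (sh (shift i X)) (shift (i + 1) X).
Proof.
apply: isomorphic_trans (shift_succ_isomorphic i X).
case: i => n; first by rewrite /= -iter_functorSr; exact: isomorphic_refl.
change (isomorphic (sh (iter_functor shV n.+1 X))
  (iter_functor shV n.+1 (sh X))).
elim: n.+1 X => {n} [|n IH] X; first exact: isomorphic_refl.
apply: isomorphic_trans (IH (shV X)) _; apply: fmap_iso.
apply: isomorphic_trans (shshV_iso X) (isomorphic_sym (shVsh_iso X)).
Qed.

Lemma zero_obj0 Z : is_zero_obj Z -> idm Z = 0.
Proof. by case=> + _; apply. Qed.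

Lemma zero_objP Z : idm Z = 0 -> is_zero_obj Z.
Proof.
move=> e; split=> X f g.
  by rewrite -[f]mcomp_idl -[g]mcomp_idl e !mcomp0l.
by rewrite -[f]mcomp_idr -[g]mcomp_idr e !mcomp0r.
Qed.

Lemma sh_zero Z : is_zero_obj Z -> is_zero_obj (sh Z).
Proof. by move/zero_obj0=> e; apply: zero_objP; rewrite -fmap1 e fmap0. Qed.

Section Distinguished.
Variables (X Y Z : C) (f : Hom X Y) (g : Hom Y Z) (h : Hom Z (sh X)).
Hypothesis fgh : dist f g h.

Lemma dist_comp0 : g \oc f = 0.
Proof.
have [Z0 zZ0] := zero_exists C.
have e : f \oc idm X = f \oc idm X by [].
have [c [_ + _]] := dist_fill (dist_id X zZ0) fgh e.
by rewrite mcomp0r.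
Qed.

Lemma dist_lift W (u : Hom W Y) : g \oc u = 0 -> exists v, f \oc v = u.
Proof.
have [Z0 zZ0] := zero_exists C => gu.
have dW := (dist_rotate _ _ _).1 (dist_id W zZ0).
have dg := (dist_rotate _ _ _).1 fgh.
have e : (0 : Hom Z0 Z) \oc (0 : Hom W Z0) = g \oc u by rewrite mcomp0l gu.
have [c [_ _ +]] := dist_fill dW dg e.
have [v <-] := sh_full c.
rewrite fmap1 mcompNr mcomp_idr mcompNl -fmapM => /oppr_inj/sh_faithful ->.
by exists v.
Qed.

Lemma dist_colift W (u : Hom Y W) : u \oc f = 0 -> exists v, v \oc g = u.
Proof.
have [Z0 zZ0] := zero_exists C => uf.
have dW : dist (0 : Hom Z0 W) (idm W) (0 : Hom W (sh Z0)).
  by apply/dist_rotate; rewrite fmap0 oppr0; exact/dist_id/sh_zero.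
have e : u \oc f = (0 : Hom Z0 W) \oc (0 : Hom X Z0) by rewrite uf mcomp0l.
have [v [_ + _]] := dist_fill fgh dW e.
by rewrite mcomp_idl => <-; exists v.
Qed.

End Distinguished.

Lemma isoN1 X : is_iso (- idm X).
Proof. by exists (- idm X); rewrite mcompNl mcomp_idl opprK. Qed.

Lemma iso1 X : is_iso (idm X).
Proof. by exists (idm X); rewrite mcomp_idl. Qed.

Lemma sh_dist X Y Z (f : Hom X Y) (g : Hom Y Z) (h : Hom Z (sh X)) :
  dist f g h -> dist (fmap sh f) (fmap sh g) (- fmap sh h).
Proof.
do 3!move/(dist_rotate _ _ _).1.
apply: (@dist_iso _ _ _ _ _ _ _ _ _ _ _ _ _ (idm _) (- idm _) (idm _));
  [|exact: iso1|exact: isoN1|exact: iso1].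
split.
- by rewrite mcompNl mcompNr opprK mcomp_idl mcomp_idr.
- by rewrite !mcompNr mcomp_idl mcomp_idr.
- by rewrite fmap1 mcomp_idl mcomp_idr.
Qed.

End TriangulatedTheory.

Section WeightTheory.
Variables (C : triangulated) (w : weight_structure C).
Implicit Types (X Y Z T M : C) (i p : int).

Lemma w_le_iso i X Y : isomorphic X Y -> w_le w i Y -> w_le w i X.
Proof.
by move=> e [T [Tw e']]; exists T; split=> //; exact: isomorphic_trans e e'.
Qed.

Lemma w_ge_iso i X Y : isomorphic X Y -> w_ge w i Y -> w_ge w i X.
Proof.
by move=> e [T [Tw e']]; exists T; split=> //; exact: isomorphic_trans e e'.
Qed.

Lemma w_ge1_sh Y : w_ge0 w Y -> shift_class (w_ge0 w) 1 (sh Y).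
Proof. by exists Y; split=> //; exact: isomorphic_refl. Qed.

Lemma w_le_sh i X : w_le w i X -> w_le w (i + 1) (sh X).
Proof.
case=> T [Tw e]; exists T; split=> //.
by apply: isomorphic_trans (fmap_iso sh e) _; exact: sh_shift_isomorphic.
Qed.

Lemma w_orth i X Y (f : Hom X Y) : w_le w i X -> w_ge w (i + 1) Y -> f = 0.
Proof.
move=> [X0 [X0w [a [a' [a'a aa']]]]] [Y0 [Y0w e]].
have [b [b' [b'b bb']]] :=
  isomorphic_trans e (isomorphic_sym (shift_succ_isomorphic i Y0)).
have [f0 f0E] := shift_full (b \oc f \oc a').
have f00 : f0 = 0 by exact: (w_orthogonal X0w (w_ge1_sh Y0w)).
rewrite -[f]mcomp_idl -b'b -[_ \oc f]mcomp_idr -a'a !mcompA.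
by rewrite -(mcompA (b' \oc b)) -!mcompA (mcompA b) (mcompA _ a') -f0E f00
  fmap0 mcomp0l mcomp0r.
Qed.

Lemma w_le_orth i X :
  (forall Y (f : Hom X Y), w_ge w (i + 1) Y -> f = 0) -> w_le w i X.
Proof.
move=> orthX; pose X' := shift (- i) X.
have eX : isomorphic X (shift i X') by exact/isomorphic_sym/shift_cancelV.
exists X'; split=> //.
have [L [R [f [g [h [Lw [R0 [R0w eR]] d]]]]]] := w_decomposition w X'.
have [a [a' [a'a aa']]] := eX.
have g0 : g = 0.
  apply: (@shift_faithful _ i); rewrite fmap0.
  rewrite -[LHS]mcomp_idr -aa' mcompA (orthX _ (_ \oc a)) ?mcomp0l //.
  exists R0; split=> //; apply: isomorphic_trans (fmap_iso (shift i) eR) _.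
  exact: shift_succ_isomorphic.
have g1 : g \oc idm X' = 0 by rewrite g0 mcomp0l.
have [v vE] := dist_lift d g1.
by apply: w_le0_retract Lw; exists v, f.
Qed.

Lemma w_ge_orth i Y :
  (forall X (f : Hom X Y), w_le w (i - 1) X -> f = 0) -> w_ge w i Y.
Proof.
move=> orthY; pose Y' := shift (- i) Y.
have eY : isomorphic Y (shift i Y') by exact/isomorphic_sym/shift_cancelV.
exists Y'; split=> //.
have [L [R [f [g [h [Lw [R0 [R0w eR]] d]]]]]] := w_decomposition w (sh Y').
have [a [a' [a'a aa']]] := eY.
have [b [b' [b'b bb']]] := shshV_iso L.
have [f0 f0E] := sh_full (f \oc b).
have f00 : f0 = 0.
  apply: (@shift_faithful _ i); rewrite fmap0.
  rewrite -[LHS]mcomp_idl -aa' -mcompA (orthY _ (a' \oc _)) ?mcomp0r //.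
  exists L; split=> //.
  have := shift_succ_isomorphic (i - 1) (shV L); rewrite subrK => e.
  apply: isomorphic_trans (isomorphic_sym e) _.
  exact/fmap_iso/shshV_iso.
have f0' : f = 0 by rewrite -[f]mcomp_idr -bb' mcompA -f0E f00 fmap0 mcomp0l.
have f1 : idm (sh Y') \oc f = 0 by rewrite f0' mcomp0r.
have [v vE] := dist_colift d f1.
have [c [c' [c'c cc']]] := eR.
have [s sE] := sh_full (c \oc g : Hom (sh Y') (sh R0)).
have [r rE] := sh_full (v \oc c' : Hom (sh R0) (sh Y')).
apply: w_ge0_retract R0w; exists s, r; apply: sh_faithful.
by rewrite fmapM fmap1 sE rE -mcompA (mcompA c') c'c mcomp_idl.
Qed.

Definition w_decomposable (i : int) (M : C) : Prop :=
  exists (L R : C) (f : Hom L M) (g : Hom M R) (h : Hom R (sh L)),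
    [/\ w_le w i L, w_ge w (i + 1) R & dist f g h].

Lemma w_ge_sh i X : w_ge w i X -> w_ge w (i + 1) (sh X).
Proof.
case=> T [Tw e]; exists T; split=> //.
by apply: isomorphic_trans (fmap_iso sh e) _; exact: sh_shift_isomorphic.
Qed.

Lemma w_le_shV i X : w_le w i X -> w_le w (i - 1) (shV X).
Proof.
move=> Xw; apply: w_le_orth => Y f Yw; apply: sh_faithful; rewrite fmap0.
have [b [b' [b'b bb']]] := shshV_iso X.
rewrite -[LHS]mcomp_idr -b'b mcompA (_ : _ \oc b' = 0) ?mcomp0l //.
by apply: w_orth Xw _; have := w_ge_sh Yw; rewrite subrK.
Qed.

Lemma w_ge_pred i X : w_ge w (i + 1) X -> w_ge w i X.
Proof.
case=> T [Tw e]; exists (sh T); split; first exact/w_ge0_shift/w_ge1_sh.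
exact: isomorphic_trans e (isomorphic_sym (shift_succ_isomorphic i T)).
Qed.

Lemma w_le_succ i X : w_le w (i - 1) X -> w_le w i X.
Proof.
move=> Xw; apply: w_le_orth => Y f Yw; apply: w_orth Xw _.
by apply: w_ge_pred; rewrite subrK.
Qed.

Lemma w_decomposable_up i :
  (forall M, w_decomposable i M) -> forall M, w_decomposable (i + 1) M.
Proof.
move=> dec M; have [L [R [f [g [h [Lw Rw d]]]]]] := dec (shV M).
have [b [b' [b'b bb']]] := shshV_iso M.
exists (sh L), (sh R), (b \oc fmap sh f), (fmap sh g \oc b'), (- fmap sh h).
split; [exact: w_le_sh|exact: w_ge_sh|].
have bi : is_iso b by exists b'.
apply: dist_iso (iso1 (sh L)) bi (iso1 (sh R)) (sh_dist d).
split; first by rewrite mcomp_idr.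
  by rewrite -mcompA b'b mcomp_idl mcomp_idr.
by rewrite fmap1 mcomp_idl mcomp_idr.
Qed.

Lemma w_decomposable_down i :
  (forall M, w_decomposable i M) -> forall M, w_decomposable (i - 1) M.
Proof.
move=> dec M; have [L [R [f [g [h [Lw Rw d]]]]]] := dec (sh M).
have [b [b' [b'b bb']]] := shshV_iso L.
have [f0 f0E] := sh_full (f \oc b).
have [Z [g0 [h0 d0]]] := dist_cone f0.
exists (shV L), Z, f0, g0, h0; split=> //; first exact: w_le_shV.
rewrite subrK; apply: w_ge_orth => T u Tw; apply: sh_faithful; rewrite fmap0.
have e : idm (sh M) \oc fmap sh f0 = f \oc b by rewrite mcomp_idl.
have [c [_ c2 c3]] := dist_fill (sh_dist d0) d e.
have cu : c \oc fmap sh u = 0.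
  by apply: (@w_orth i) => //; rewrite -(subrK 1 i); exact: w_le_sh.
have hu : fmap sh h0 \oc fmap sh u = 0.
  have : fmap sh b \oc (- fmap sh h0) \oc fmap sh u = 0.
    by rewrite c3 -mcompA cu mcomp0r.
  move/(congr1 (mcomp (fmap sh b'))).
  rewrite mcomp0r !mcompA -fmapM b'b fmap1 mcomp_idl mcompNl.
  by move/eqP; rewrite oppr_eq0 => /eqP.
have hu' : - fmap sh h0 \oc fmap sh u = 0 by rewrite mcompNl hu oppr0.
have [x xE] := dist_lift ((dist_rotate _ _ _).1 (sh_dist d0)) hu'.
have gx : g \oc x = 0 by rewrite -[g]mcomp_idr -c2 -mcompA xE cu.
have [y yE] := dist_lift d gx.
rewrite -xE -yE -[f]mcomp_idr -bb' (mcompA f) -f0E !mcompA -fmapM.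
by rewrite (dist_comp0 d0) fmap0 !mcomp0l.
Qed.

Lemma w_decomposable_all i M : w_decomposable i M.
Proof.
have dec0 N : w_decomposable 0 N.
  have [L [R [f [g [h [Lw Rw d]]]]]] := w_decomposition w N.
  exists L, R, f, g, h; split=> //.
  by exists L; split=> //; exact: isomorphic_refl.
elim/int_rec: i M => [//|n IH|n IH] M.
  by rewrite -addn1 PoszD; exact: w_decomposable_up.
by rewrite -addn1 PoszD opprD; exact: w_decomposable_down.
Qed.

Lemma weight_data_exists (M : C) : inhabited (weight_data w M).
Proof.
have tP i : exists t : {L : C & {R : C & Hom L M * Hom M R * Hom R (sh L)}}%type,
    [/\ w_le w i (projT1 t), w_ge w (i + 1) (projT1 (projT2 t)) &
      dist (projT2 (projT2 t)).1.1 (projT2 (projT2 t)).1.2 (projT2 (projT2 t)).2].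
  have [L [R [f [g [h H]]]]] := w_decomposable_all i M.
  by exists (existT _ L (existT _ R (f, g, h))).
pose L i := projT1 (projT1 (cid (tP i))).
pose R i := projT1 (projT2 (projT1 (cid (tP (i - 1))))).
have dP i : exists t : Hom (L i) M * Hom M (R (i + 1)) * Hom (R (i + 1)) (sh (L i)),
    dist t.1.1 t.1.2 t.2.
  rewrite /R addrK /L; case: cid => -[L0 [R0 [[f g] h]]] [_ _ d] /=.
  by exists (f, g, h).
have Lw i : w_le w i (L i) by rewrite /L; case: cid => t [].
have Rw i : w_ge w i (R i).
  by rewrite /R; case: cid => t [_ + _] /=; rewrite subrK.
pose d i := projT1 (cid (dP i)).
have dE i : dist (d i).1.1 (d i).1.2 (d i).2 by rewrite /d; case: cid.
have jP i : exists j : Hom (L (i - 1)) (L i), (d i).1.1 \oc j = (d (i - 1)).1.1.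
  apply: (dist_lift (dE i)).
  by apply: (@w_orth i) => //; exact: w_le_succ.
pose j i := projT1 (cid (jP i)).
have jE i : (d i).1.1 \oc j i = (d (i - 1)).1.1 by rewrite /j; case: cid.
have cP i : exists t : {Z : C & Hom (L i) Z * Hom Z (sh (L (i - 1)))}%type,
    dist (j i) (projT2 t).1 (projT2 t).2.
  by have [Z [a [b H]]] := dist_cone (j i); exists (existT _ Z (a, b)).
pose c i := projT1 (cid (cP i)).
have cE i : dist (j i) (projT2 (c i)).1 (projT2 (c i)).2 by rewrite /c; case: cid.
constructor.
exact: (@WeightData C w M L R (fun i => (d i).1.1) (fun i => (d i).1.2)
  (fun i => (d i).2) Lw Rw dE j jE (fun i => projT1 (c i))
  (fun i => (projT2 (c i)).1) (fun i => (projT2 (c i)).2) cE).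
Qed.

Section WeightData.
Variables (M : C) (D : weight_data w M).

Lemma wM_le i : w_le w i (wM D i).
Proof.
apply: w_le_orth => T f Tge; have dD := wM_dist D i.
have fa : f \oc wa D i = 0 by apply: w_orth Tge; exact: wle_le.
have [v <-] := dist_colift ((dist_rotate _ _ _).1 dD) fa.
suff -> : v = 0 by rewrite mcomp0l.
by apply: w_orth Tge; rewrite -{1}(subrK 1 i); apply/w_le_sh/wle_le.
Qed.

Lemma wM_ge i : w_ge w i (wM D i).
Proof.
apply: w_ge_orth => T f Tle.
have d1 := w_dist D (i - 1); rewrite -wh_wj in d1.
have [u [v [d _ _ _ _]]] := dist_octahedral (wM_dist D i) (w_dist D i) d1.
have uf : u \oc f = 0 by apply: w_orth Tle _; exact: wge_ge.
have {}d := (dist_rotate _ _ _).1 ((dist_rotate _ _ _).1 d).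
have uf' : - fmap sh u \oc fmap sh f = 0.
  by rewrite mcompNl -fmapM uf fmap0 oppr0.
have [x xE] := dist_lift d uf'.
have x0 : x = 0.
  apply: (@w_orth i); last exact: wge_ge.
  by rewrite -(subrK 1 i); exact: w_le_sh.
by apply: sh_faithful; rewrite -xE x0 mcomp0r fmap0.
Qed.

Lemma shift_wM_heart p : in_heart w (shift p (wM D (- p))).
Proof.
split.
  have [Y [Yw e]] := wM_le (- p); apply: w_le0_retract Yw.
  apply/isomorphic_retract/(isomorphic_trans (fmap_iso (shift p) e)).
  exact: shift_cancelV.
have [Y [Yw e]] := wM_ge (- p); apply: w_ge0_retract Yw.
apply/isomorphic_retract/(isomorphic_trans (fmap_iso (shift p) e)).
exact: shift_cancelV.
Qed.

End WeightData.

Lemma weight_data_mor_exists (M M' : C) (g : Hom M M')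
    (D : weight_data w M) (D' : weight_data w M') :
  exists _ : weight_data_mor g D D', True.
Proof.
have lP i : exists l : Hom (wle D i) (wle D' i), wh D' i \oc l = g \oc wh D i.
  apply: (dist_lift (w_dist D' i)).
  by apply: (@w_orth i); [exact: wle_le|exact: wge_ge].
pose l i := projT1 (cid (lP i)).
have lE i : g \oc wh D i = wh D' i \oc l i by rewrite /l; case: cid.
have rP i := dist_fill (w_dist D i) (w_dist D' i) (lE i).
pose r i := projT1 (cid (rP i)).
have rE i : is_tri_mor (wh D i) (wr D i) (wd D i)
    (wh D' i) (wr D' i) (wd D' i) (l i) g (r i) by rewrite /r; case: cid.
have jE i : l i \oc wj D i = wj D' i \oc l (i - 1).
  apply/eqP; rewrite -subr_eq0; apply/eqP; set x := (X in X = 0).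
  have hx : wh D' i \oc x = 0.
    by rewrite mcompBr !mcompA -lE wh_wj -mcompA wh_wj lE subrr.
  have d := w_dist D' i.
  have {}d := (dist_rotate _ _ _).1 ((dist_rotate _ _ _).1 d).
  have hx' : - fmap sh (wh D' i) \oc fmap sh x = 0.
    by rewrite mcompNl -fmapM hx fmap0 oppr0.
  have [y yE] := dist_lift d hx'.
  have y0 : y = 0.
    apply: (@w_orth i); last exact: wge_ge.
    by rewrite -{1}(subrK 1 i); apply/w_le_sh/wle_le.
  by apply: sh_faithful; rewrite -yE y0 mcomp0r fmap0.
have cP i := dist_fill (wM_dist D i) (wM_dist D' i) (jE i).
pose c i := projT1 (cid (cP i)).
have cE i : is_tri_mor (wj D i) (wa D i) (wb D i)
    (wj D' i) (wa D' i) (wb D' i) (l (i - 1)) (l i) (c i).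
  by rewrite /c; case: cid.
by exists (WeightDataMor rE cE).
Qed.

End WeightTheory.

Record complex (C : preadditive) := Complex {
  cx :> int -> C;
  cd : forall p : int, Hom (cx p) (cx (p + 1));
  cd_cd : forall p : int, cd (p + 1) \oc cd p = 0 }.

Record complex_mor (C : preadditive) (K L : complex C) := ComplexMor {
  cm : forall p : int, Hom (K p) (L p);
  cm_cd : forall p : int, cm (p + 1) \oc cd K p = cd L p \oc cm p }.

Lemma map_complex_subproof (C D : preadditive) (F : additive_functor C D)
    (K : complex C) (p : int) : fmap F (cd K (p + 1)) \oc fmap F (cd K p) = 0.
Proof. by rewrite -fmapM cd_cd fmap0. Qed.

Definition map_complex (C D : preadditive) (F : additive_functor C D)
    (K : complex C) : complex D :=
  Complex (map_complex_subproof F K).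

Lemma map_complex_mor_subproof (C D : preadditive) (F : additive_functor C D)
    (K L : complex C) (u : complex_mor K L) (p : int) :
  fmap F (cm u (p + 1)) \oc cd (map_complex F K) p =
  cd (map_complex F L) p \oc fmap F (cm u p).
Proof. by rewrite -!fmapM cm_cd. Qed.

Definition map_complex_mor (C D : preadditive) (F : additive_functor C D)
    (K L : complex C) (u : complex_mor K L) :
    complex_mor (map_complex F K) (map_complex F L) :=
  @ComplexMor D (map_complex F K) (map_complex F L)
    (fun p => fmap F (cm u p)) (map_complex_mor_subproof F u).

Definition nat_complex_mor (C D : preadditive) (F G : additive_functor C D)
    (phi : nat_trans F G) (K : complex C) :
    complex_mor (map_complex F K) (map_complex G K) :=
  @ComplexMor D (map_complex F K) (map_complex G K) (fun p => phi (K p))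
    (fun p => nt_natural phi (cd K p)).

Section Homology.
Variable A : abelian.
Implicit Types X Y Z : A.

Lemma kernel_exists_sig X Y (f : Hom X Y) :
  exists k : {K : A & Hom K X}, is_kernel f (projT2 k).
Proof. by have [K [k kP]] := kernel_exists f; exists (existT _ K k). Qed.

Lemma cokernel_exists_sig X Y (f : Hom X Y) :
  exists q : {Q : A & Hom Y Q}, is_cokernel f (projT2 q).
Proof. by have [Q [q qP]] := cokernel_exists f; exists (existT _ Q q). Qed.

Definition ker X Y (f : Hom X Y) : A :=
  projT1 (projT1 (cid (kernel_exists_sig f))).

Definition ker_inc X Y (f : Hom X Y) : Hom (ker f) X :=
  projT2 (projT1 (cid (kernel_exists_sig f))).

Lemma kerP X Y (f : Hom X Y) : is_kernel f (ker_inc f).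
Proof. exact: projT2 (cid (kernel_exists_sig f)). Qed.

Definition coker X Y (f : Hom X Y) : A :=
  projT1 (projT1 (cid (cokernel_exists_sig f))).

Definition coker_proj X Y (f : Hom X Y) : Hom Y (coker f) :=
  projT2 (projT1 (cid (cokernel_exists_sig f))).

Lemma cokerP X Y (f : Hom X Y) : is_cokernel f (coker_proj f).
Proof. exact: projT2 (cid (cokernel_exists_sig f)). Qed.

Lemma ker_lift_exists X Y W (f : Hom X Y) (g : Hom W X) (fg : f \oc g = 0) :
  exists u, ker_inc f \oc u = g.
Proof. by have [u [uE _]] := (kerP f).2 W g fg; exists u. Qed.

Definition ker_lift X Y W (f : Hom X Y) (g : Hom W X) (fg : f \oc g = 0) :
  Hom W (ker f) := projT1 (cid (ker_lift_exists fg)).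

Lemma ker_liftE X Y W (f : Hom X Y) (g : Hom W X) (fg : f \oc g = 0) :
  ker_inc f \oc ker_lift fg = g.
Proof. exact: projT2 (cid (ker_lift_exists fg)). Qed.

Lemma coker_desc_exists X Y W (f : Hom X Y) (g : Hom Y W) (gf : g \oc f = 0) :
  exists u, u \oc coker_proj f = g.
Proof. by have [u [uE _]] := (cokerP f).2 W g gf; exists u. Qed.

Definition coker_desc X Y W (f : Hom X Y) (g : Hom Y W) (gf : g \oc f = 0) :
  Hom (coker f) W := projT1 (cid (coker_desc_exists gf)).

Lemma coker_descE X Y W (f : Hom X Y) (g : Hom Y W) (gf : g \oc f = 0) :
  coker_desc gf \oc coker_proj f = g.
Proof. exact: projT2 (cid (coker_desc_exists gf)). Qed.

Lemma ker_inc_mono X Y (f : Hom X Y) : is_mono (ker_inc f).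
Proof.
move=> W u v e.
have fu : f \oc (ker_inc f \oc u) = 0.
  by rewrite mcompA (kerP f).1 mcomp0l.
by have [x [_ xU]] := (kerP f).2 W _ fu; rewrite -(xU u) // -(xU v).
Qed.

(* The cokernel of X -> ker g. *)
Definition homology X Y Z (f : Hom X Y) (g : Hom Y Z) (gf : g \oc f = 0) : A :=
  coker (ker_lift gf).

Section HomologyMap.
Variables (X Y Z X' Y' Z' : A) (f : Hom X Y) (g : Hom Y Z)
  (f' : Hom X' Y') (g' : Hom Y' Z') (gf : g \oc f = 0) (gf' : g' \oc f' = 0)
  (a : Hom X X') (b : Hom Y Y') (c : Hom Z Z')
  (ab : b \oc f = f' \oc a) (bc : c \oc g = g' \oc b).

Lemma cycles_map_subproof : g' \oc (b \oc ker_inc g) = 0.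
Proof. by rewrite mcompA -bc -mcompA (kerP g).1 mcomp0r. Qed.

Definition cycles_map : Hom (ker g) (ker g') := ker_lift cycles_map_subproof.

Lemma homology_map_subproof :
  coker_proj (ker_lift gf') \oc cycles_map \oc ker_lift gf = 0.
Proof.
have e : cycles_map \oc ker_lift gf = ker_lift gf' \oc a.
  apply: (@ker_inc_mono _ _ g').
  by rewrite !mcompA !ker_liftE -mcompA ker_liftE.
by rewrite -mcompA e mcompA (cokerP _).1 mcomp0l.
Qed.

Definition homology_map : Hom (homology gf) (homology gf') :=
  coker_desc homology_map_subproof.

End HomologyMap.

Definition is_exact X Y Z (f : Hom X Y) (g : Hom Y Z) : Prop :=
  exists gf : g \oc f = 0, is_zero_obj (homology gf).

(* Zeroth homology; -1 + 1 is convertible to 0. *)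
Definition H0 (K : complex A) : A :=
  @homology (K (- 1)) (K 0) (K (0 + 1)) (cd K (- 1)) (cd K 0) (cd_cd K (- 1)).

Definition H0_map (K L : complex A) (u : complex_mor K L) :
    Hom (H0 K) (H0 L) :=
  @homology_map (K (- 1)) (K 0) (K (0 + 1)) (L (- 1)) (L 0) (L (0 + 1))
    (cd K (- 1)) (cd K 0) (cd L (- 1)) (cd L 0)
    (cd_cd K (- 1)) (cd_cd L (- 1))
    (cm u (- 1)) (cm u 0) (cm u (0 + 1)) (cm_cd u (- 1)) (cm_cd u 0).

End Homology.

Definition is_homological (C : triangulated) (A : abelian)
    (Ho : C -> A) (Hm : forall X Y : C, Hom X Y -> Hom (Ho X) (Ho Y)) : Prop :=
  [/\ is_functor Hm, is_additive Hm &
    forall (X Y Z : C) (f : Hom X Y) (g : Hom Y Z) (h : Hom Z (sh X)),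
      dist f g h -> is_exact (Hm X Y f) (Hm Y Z g)].

Section WeightComplex.
Variables (C : triangulated) (w : weight_structure C).

Lemma opp_succ (p : int) : - p - 1 = - (p + 1).
Proof. by rewrite opprD. Qed.

Section Object.
Variables (M : C) (D : weight_data w M).

(* M_i -> w_{<=i-1}M[1] -> M_{i-1}[1] *)
Definition wM_boundary (i : int) : Hom (wM D i) (sh (wM D (i - 1))) :=
  fmap sh (wa D (i - 1)) \oc wb D i.

Definition weight_complex_obj (p : int) : heart w :=
  exist (in_heart w) (shift p (wM D (- p))) (shift_wM_heart D p).

(* The shift by [p] of M_{-p} -> M_{-p-1}[1], up to the identification of
   M_{-p-1}[1][p] with M_{-(p+1)}[p+1]. *)
Definition weight_complex_d (p : int) :
    Hom (shift p (wM D (- p))) (shift (p + 1) (wM D (- (p + 1)))) :=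
  fmap (shift (p + 1)) (transport (wM D) (opp_succ p)) \oc
  (shift_succ p (wM D (- p - 1)) \oc fmap (shift p) (wM_boundary (- p))).

Lemma wM_boundary2 (i : int) :
  fmap sh (wM_boundary (i - 1)) \oc wM_boundary i = 0.
Proof.
rewrite fmapM -mcompA [fmap sh (wb D _) \oc _]mcompA -fmapM.
rewrite (dist_comp0 ((dist_rotate _ _ _).1 (wM_dist D (i - 1)))).
by rewrite fmap0 mcomp0l mcomp0r.
Qed.

Lemma weight_complex_dd (p : int) :
  weight_complex_d (p + 1) \oc weight_complex_d p = 0.
Proof.
rewrite /weight_complex_d.
set t := transport _ (opp_succ p); set t' := transport _ _.
set s := shift_succ p _; set s' := shift_succ _ _.
suff e : fmap (shift (p + 1)) (wM_boundary (- (p + 1))) \oc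
    (fmap (shift (p + 1)) t \oc (s \oc fmap (shift p) (wM_boundary (- p)))) = 0.
  by rewrite -!mcompA e !mcomp0r.
rewrite mcompA -fmapM (transport_natural wM_boundary) fmapM -mcompA.
rewrite (mcompA _ s) -shift_succ_natural -mcompA -fmapM wM_boundary2.
by rewrite fmap0 !mcomp0r.
Qed.

Definition weight_complex : complex (heart w) :=
  @Complex (heart w) weight_complex_obj weight_complex_d weight_complex_dd.

End Object.

Section Morphism.
Variables (M M' : C) (g : Hom M M').
Variables (D : weight_data w M) (D' : weight_data w M').
Variable e : weight_data_mor g D D'.

Lemma wM_boundary_natural (i : int) :
  fmap sh (mM e (i - 1)) \oc wM_boundary D i = wM_boundary D' i \oc mM e i.
Proof.
have [_ _ eb] := mM_tri e i; have [_ ea _] := mM_tri e (i - 1).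
by rewrite /wM_boundary mcompA -fmapM ea fmapM -!mcompA eb.
Qed.

Lemma weight_complex_mor_subproof (p : int) :
  fmap (shift (p + 1)) (mM e (- (p + 1))) \oc weight_complex_d D p =
  weight_complex_d D' p \oc fmap (shift p) (mM e (- p)).
Proof.
rewrite /weight_complex_d mcompA -fmapM (transport_natural (mM e)) fmapM.
rewrite -!mcompA; congr (_ \oc _).
rewrite [LHS]mcompA -shift_succ_natural -mcompA -!fmapM.
by rewrite wM_boundary_natural.
Qed.

Definition weight_complex_mor :
    complex_mor (weight_complex D) (weight_complex D') :=
  @ComplexMor (heart w) (weight_complex D) (weight_complex D')
    (fun p => fmap (shift p) (mM e (- p))) weight_complex_mor_subproof.

End Morphism.
End WeightComplex.

Section PureFunctor.
Variables (C : triangulated) (w : weight_structure C) (A : abelian).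
Implicit Types F G : additive_functor (heart w) A.

Definition pure_obj F (M : C) (D : weight_data w M) : A :=
  H0 (map_complex F (weight_complex D)).

Definition pure_mor F (M M' : C) (g : Hom M M')
    (D : weight_data w M) (D' : weight_data w M') (e : weight_data_mor g D D') :
    Hom (pure_obj F D) (pure_obj F D') :=
  H0_map (map_complex_mor F (weight_complex_mor e)).

(* The value on g, computed with an arbitrarily chosen extension of g. *)
Definition pure_map F (M M' : C) (D : weight_data w M) (D' : weight_data w M')
    (g : Hom M M') : Hom (pure_obj F D) (pure_obj F D') :=
  pure_mor F (projT1 (cid (weight_data_mor_exists g D D'))).

Definition pure_nat F G (phi : nat_trans F G) (M : C) (D : weight_data w M) :
    Hom (pure_obj F D) (pure_obj G D) :=
  H0_map (nat_complex_mor phi (weight_complex D)).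

Variable t : forall M : C, weight_data w M.

Definition H_obj F (M : C) : A := pure_obj F (t M).

Definition H_map F (M N : C) (g : Hom M N) : Hom (H_obj F M) (H_obj F N) :=
  pure_map F (t M) (t N) g.

Definition H_nat F G (phi : nat_trans F G) (M : C) :
  Hom (H_obj F M) (H_obj G M) := pure_nat phi (t M).

End PureFunctor.

(* The comparison between two choices: the map induced by the identity of M. *)
Definition H_comparison (C : triangulated) (w : weight_structure C) (A : abelian)
    (F : additive_functor (heart w) A) (t t' : forall M : C, weight_data w M)
    (M : C) : Hom (H_obj t F M) (H_obj t' F M) :=
  pure_map F (t M) (t' M) (idm M).

(* Main.v *)
(* An extension of 0 : M -> M' to the chosen data need not vanish on M_i, but by
   orthogonality it is there the sum of a map factoring through the differential
   out of M_i and a map factoring through the differential into M'_i.  Hence it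
   induces 0 on homology, which makes H an additive functor independent of the
   choices.

   For exactness on X -> Y -> Z we may thus choose the data of Y: the truncation
   triangles of X and Z at -1 are spliced into one for Y, so that w_{<=-1} and
   w_{>=0} send X -> Y -> Z to distinguished triangles.  For N in C_{w<=0},
   Hom(N, w_{>=0}M) is the cokernel of Hom(N, M^{-1}) -> Hom(N, M^0), so taking
   N = Z^0, Y^0, Z^{-1} gives maps that split X^0 -> Y^0 -> Z^0 modulo
   boundaries; dually, extending maps along w_{<=-1}X -> w_{<=-1}Y gives a map
   Y^1 -> X^1 that is a retraction on the image of the differential of X.
   These identities persist under any additive functor and suffice for the
   diagram chase. *)

Require Import Defs.
From mathcomp Require Import all_boot ssralg ssrint.
From mathcomp Require Import boolp.

Set Implicit Arguments.
Unset Strict Implicit.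
Unset Printing Implicit Defensive.
Import GRing.Theory.
Local Open Scope ring_scope.

(** * Epimorphisms in preadditive categories *)

Section Preadditive.
Variable C : preadditive.
Implicit Types X Y Z W : C.

Lemma is_epi_comp X Y Z (g : Hom Y Z) (f : Hom X Y) :
  is_epi g -> is_epi f -> is_epi (g \oc f).
Proof. by move=> gE fE W u v; rewrite !mcompA => /fE/gE. Qed.

Lemma is_epi_cancel0 X Y (f : Hom X Y) :
  (forall W (u : Hom Y W), u \oc f = 0 -> u = 0) -> is_epi f.
Proof.
by move=> fE W u v /eqP; rewrite -subr_eq0 -mcompBl => /eqP/fE/eqP;
  rewrite subr_eq0 => /eqP.
Qed.

Lemma is_epi0 X Y W (f : Hom X Y) (u : Hom Y W) :
  is_epi f -> u \oc f = 0 -> u = 0.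
Proof. by move=> fE uf; apply: fE; rewrite uf mcomp0l. Qed.

Lemma is_epi_of_comp X Y Z (g : Hom Y Z) (f : Hom X Y) :
  is_epi (g \oc f) -> is_epi g.
Proof. by move=> gfE W u v e; apply: gfE; rewrite !mcompA e. Qed.

Lemma is_epi_cokernel X Y Q (f : Hom X Y) (q : Hom Y Q) :
  is_cokernel f q -> is_epi q.
Proof.
move=> [qf qU] W u v e.
have uqf : u \oc q \oc f = 0 by rewrite -mcompA qf mcomp0r.
by have [x [_ xU]] := qU W _ uqf; rewrite -(xU u) // -(xU v).
Qed.

Lemma is_zero_obj_idm Z : idm Z = 0 -> is_zero_obj Z.
Proof.
move=> e; split=> X f g.
  by rewrite -[f]mcomp_idl -[g]mcomp_idl e !mcomp0l.
by rewrite -[f]mcomp_idr -[g]mcomp_idr e !mcomp0r.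
Qed.

End Preadditive.

(** * Diagram chases in an abelian category by generalized elements *)

Section Abelian.
Variable A : abelian.
Implicit Types X Y Z W : A.

Lemma epi_cokernel_ker X Y T (p : Hom X Y) (v : Hom X T) :
  is_epi p -> v \oc ker_inc p = 0 -> exists q, v = q \oc p.
Proof.
move=> /epi_is_cokernel[W [k [pk kU]]] vK.
have vk : v \oc k = 0.
  have [u <-] := ker_lift_exists pk.
  by rewrite mcompA vK mcomp0l.
by have [q [qE _]] := kU _ _ vk; exists q.
Qed.

(** Epimorphisms are stable under pullback; the pullback of [p] and [y] is the kernel of [d].
    Preimages of generalized elements thus exist after an epimorphic change of domain. *)
Lemma epi_lift X Y W (p : Hom X Y) (y : Hom W Y) : is_epi p ->
  exists (P : A) (q : Hom P W) (x : Hom P X), is_epi q /\ p \oc x = y \oc q.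
Proof.
move=> pE; have [B [i1 [i2 [p1 [p2 [p1i1 p2i2 p2i1 p1i2 _]]]]]] :=
  biproduct_exists X W.
pose d := p \oc p1 - y \oc p2.
have di1 : d \oc i1 = p.
  by rewrite mcompBl -!mcompA p1i1 p2i1 mcomp0r subr0 mcomp_idr.
have dE : is_epi d by apply: (@is_epi_of_comp _ _ _ _ d i1); rewrite di1.
exists (ker d), (p2 \oc ker_inc d), (p1 \oc ker_inc d); split; last first.
  by apply/eqP; rewrite -subr_eq0 !mcompA -mcompBl (kerP d).1.
apply: is_epi_cancel0 => T v; rewrite mcompA => /(epi_cokernel_ker dE)[q qE].
have q0 : q = 0.
  by apply: (is_epi0 pE); rewrite -di1 mcompA -qE -mcompA p2i1 mcomp0r.
by rewrite -[v]mcomp_idr -p2i2 mcompA qE q0 !mcomp0l.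
Qed.

(** The kernel of the cokernel is the image: if [v] kills [e], then [f] factors through the smaller
    subobject [k \oc i]. This is the kernel of some [g], and [g] kills [f], hence [k], so [i] has a
    section and [v = 0]. *)
Lemma mono_factor_epi X Y (f : Hom X Y) (e : Hom X (ker (coker_proj f))) :
  ker_inc (coker_proj f) \oc e = f -> is_epi e.
Proof.
set k := ker_inc _ => ke; apply: is_epi_cancel0 => T v ve.
pose i := ker_inc v; have [e' ie'] := ker_lift_exists ve.
have kiM : is_mono (k \oc i).
  by move=> W a b; rewrite -!mcompA => /ker_inc_mono/ker_inc_mono.
have [Z [g [gki gU]]] := mono_is_kernel kiM.
have gf : g \oc f = 0 by rewrite -ke -ie' (mcompA k) mcompA gki mcomp0l.
have [g' g'E] := coker_desc_exists gf.
have gk : g \oc k = 0 by rewrite -g'E -mcompA (kerP _).1 mcomp0r.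
have [s [sE _]] := gU _ _ gk.
have is1 : i \oc s = idm _.
  by apply: (@ker_inc_mono _ _ _ (coker_proj f)); rewrite mcompA mcomp_idr.
by rewrite -[v]mcomp_idr -is1 mcompA (kerP v).1 mcomp0l.
Qed.

Lemma coker_proj_eq0 X Y W (f : Hom X Y) (z : Hom W Y) :
  coker_proj f \oc z = 0 ->
  exists (P : A) (q : Hom P W) (x : Hom P X), is_epi q /\ f \oc x = z \oc q.
Proof.
move=> qz; have [e eE] := ker_lift_exists (cokerP f).1.
have [z' z'E] := ker_lift_exists qz.
have [P [q [x [qE xE]]]] := epi_lift z' (mono_factor_epi eE).
by exists P, q, x; split=> //; rewrite -eE -z'E -!mcompA xE.
Qed.

Lemma coker_proj_epi X Y (f : Hom X Y) : is_epi (coker_proj f).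
Proof. exact: is_epi_cokernel (cokerP f). Qed.

Lemma is_exactP X Y Z (f : Hom X Y) (g : Hom Y Z) : g \oc f = 0 ->
  (forall W (y : Hom W Y), g \oc y = 0 ->
    exists (P : A) (q : Hom P W) (x : Hom P X),
      is_epi q /\ f \oc x = y \oc q) ->
  is_exact f g.
Proof.
move=> gf ex; exists gf.
(* The kernel inclusion is the universal generalized element killed by [g]. *)
have [P [q [x [qE xE]]]] := ex _ _ (kerP g).1.
have kx : ker_lift gf \oc x = q.
  by apply: (@ker_inc_mono _ _ _ g); rewrite mcompA ker_liftE.
apply: is_zero_obj_idm.
apply: (is_epi0 (@coker_proj_epi _ _ (ker_lift gf))).
apply: (is_epi0 qE).
by rewrite mcomp_idl -kx mcompA (cokerP _).1 mcomp0l.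
Qed.

(* The cycle [c], a generalized element of Y, represents the generalized
   element [y] of the homology at Y. *)
Definition hclass X Y Z (f : Hom X Y) (g : Hom Y Z) (gf : g \oc f = 0) W
    (c : Hom W Y) (y : Hom W (homology gf)) : Prop :=
  exists2 z, ker_inc g \oc z = c & coker_proj (ker_lift gf) \oc z = y.

Section Classes.
Variables (X Y Z : A) (f : Hom X Y) (g : Hom Y Z) (gf : g \oc f = 0).

Lemma hclass_cycle W (c : Hom W Y) (y : Hom W (homology gf)) :
  hclass c y -> g \oc c = 0.
Proof. by case=> z <- _; rewrite mcompA (kerP g).1 mcomp0l. Qed.

Lemma hclass_exists W (c : Hom W Y) : g \oc c = 0 ->
  exists y : Hom W (homology gf), hclass c y.
Proof.
by move=> gc; have [z zE] := ker_lift_exists gc; eexists; exists z.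
Qed.

Lemma hclass_repr W (y : Hom W (homology gf)) :
  exists (P : A) (q : Hom P W) (c : Hom P Y), is_epi q /\ hclass c (y \oc q).
Proof.
have [P [q [z [qE zE]]]] := epi_lift y (@coker_proj_epi _ _ (ker_lift gf)).
by exists P, q, (ker_inc g \oc z); split=> //; exists z.
Qed.

Lemma hclass_inj W (c : Hom W Y) (y y' : Hom W (homology gf)) :
  hclass c y -> hclass c y' -> y = y'.
Proof. by case=> z <- <- [z' /ker_inc_mono -> <-]. Qed.

Lemma hclass_comp W P (c : Hom W Y) (y : Hom W (homology gf)) (q : Hom P W) :
  hclass c y -> hclass (c \oc q) (y \oc q).
Proof. by case=> z <- <-; exists (z \oc q); rewrite mcompA. Qed.

Lemma hclassD W (c c' : Hom W Y) (y y' : Hom W (homology gf)) :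
  hclass c y -> hclass c' y' -> hclass (c + c') (y + y').
Proof. by case=> z <- <- [z' <- <-]; exists (z + z'); rewrite mcompDr. Qed.

Lemma hclass_boundary W (b : Hom W X) : @hclass _ _ _ _ _ gf _ (f \oc b) 0.
Proof.
exists (ker_lift gf \oc b); rewrite mcompA ?ker_liftE //.
by rewrite (cokerP _).1 mcomp0l.
Qed.

Lemma hclass0 W (c : Hom W Y) : @hclass _ _ _ _ _ gf _ c 0 ->
  exists (P : A) (q : Hom P W) (b : Hom P X), is_epi q /\ f \oc b = c \oc q.
Proof.
case=> z <- /coker_proj_eq0[P [q [b [qE bE]]]]; exists P, q, b; split=> //.
by rewrite -mcompA -bE mcompA ker_liftE.
Qed.

(** It suffices to test on the universal class, the projection of the cycles onto homology, which is
    epi. *)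
Lemma homology_ext T (a b : Hom (homology gf) T) :
  (forall W (c : Hom W Y) y, hclass c y -> a \oc y = b \oc y) -> a = b.
Proof.
move=> ab; apply: (@coker_proj_epi _ _ (ker_lift gf)); apply: ab.
by exists (idm _); rewrite mcomp_idr.
Qed.

End Classes.

Lemma hclass_map X Y Z X' Y' Z' (f : Hom X Y) (g : Hom Y Z)
    (f' : Hom X' Y') (g' : Hom Y' Z') (gf : g \oc f = 0) (gf' : g' \oc f' = 0)
    (a : Hom X X') (b : Hom Y Y') (c : Hom Z Z')
    (ab : b \oc f = f' \oc a) (bc : c \oc g = g' \oc b)
    W (x : Hom W Y) (y : Hom W (homology gf)) :
  hclass x y -> hclass (b \oc x) (homology_map gf gf' ab bc \oc y).
Proof.
case=> z <- <-; exists (cycles_map bc \oc z).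
  by rewrite mcompA ker_liftE mcompA.
by rewrite mcompA [RHS]mcompA coker_descE.
Qed.

Section HomotopicMaps.
Variables (X Y Z X' Y' Z' : A) (f : Hom X Y) (g : Hom Y Z)
  (f' : Hom X' Y') (g' : Hom Y' Z') (gf : g \oc f = 0) (gf' : g' \oc f' = 0)
  (a a1 : Hom X X') (b b1 : Hom Y Y') (c c1 : Hom Z Z')
  (ab : b \oc f = f' \oc a) (bc : c \oc g = g' \oc b)
  (ab1 : b1 \oc f = f' \oc a1) (bc1 : c1 \oc g = g' \oc b1).

(** On cycles [z \oc g] vanishes and [f' \oc s] gives boundaries, so [z] and [s] need not be
    related. *)
Lemma homology_map_homotopic (z : Hom Z Y') (s : Hom Y X') :
  b = b1 + (z \oc g + f' \oc s) ->
  homology_map gf gf' ab bc = homology_map gf gf' ab1 bc1.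
Proof.
move=> bE; apply: homology_ext => W x y xy.
apply: (hclass_inj (hclass_map gf' ab bc xy)).
rewrite -[_ \oc y]addr0 bE !mcompDl; apply: hclassD; first exact: hclass_map.
rewrite -mcompA (hclass_cycle xy) mcomp0r add0r -mcompA.
exact: hclass_boundary.
Qed.

End HomotopicMaps.

Section ExactMaps.
Variables (X1 Y1 Z1 X2 Y2 Z2 X3 Y3 Z3 : A)
  (f1 : Hom X1 Y1) (g1 : Hom Y1 Z1) (gf1 : g1 \oc f1 = 0)
  (f2 : Hom X2 Y2) (g2 : Hom Y2 Z2) (gf2 : g2 \oc f2 = 0)
  (f3 : Hom X3 Y3) (g3 : Hom Y3 Z3) (gf3 : g3 \oc f3 = 0)
  (a : Hom X1 X2) (b : Hom Y1 Y2) (c : Hom Z1 Z2)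
  (a' : Hom X2 X3) (b' : Hom Y2 Y3) (c' : Hom Z2 Z3)
  (ab : b \oc f1 = f2 \oc a) (bc : c \oc g1 = g2 \oc b)
  (ab' : b' \oc f2 = f3 \oc a') (bc' : c' \oc g2 = g3 \oc b').

(* The hypotheses relax degreewise split exactness: up to boundaries in the
   middle degree, and on the image of the differential in the next one. *)
Lemma homology_map_exact (s : Hom Y3 Y2) (r : Hom Y2 Y1) (t : Hom Y2 X2)
    (r' : Hom X3 Y1) (t' : Hom X3 X2) (p : Hom Z2 Z1) :
  idm Y2 = s \oc b' + b \oc r + f2 \oc t ->
  s \oc f3 = b \oc r' + f2 \oc t' ->
  p \oc c \oc g1 = g1 ->
  forall W (y : Hom W (homology gf2)), homology_map gf2 gf3 ab' bc' \oc y = 0 ->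
  exists (P : A) (q : Hom P W) (x : Hom P (homology gf1)),
    is_epi q /\ homology_map gf1 gf2 ab bc \oc x = y \oc q.
Proof.
move=> e1 e2 e3 W y vy.
have [P [q [d [qE dy]]]] := hclass_repr y.
have := hclass_map gf3 ab' bc' dy; rewrite mcompA vy mcomp0l.
case/hclass0=> P' [q' [h [q'E hE]]].
have {}dy := hclass_comp q' dy; rewrite -mcompA in hE.
set d' := d \oc q' in dy hE.
(* Apply the first identity to [d'], replace [b' \oc d'] by [f3 \oc h], then use the second one. *)
pose x := r \oc d' + r' \oc h; pose h' := t \oc d' + t' \oc h.
have dE : d' = b \oc x + f2 \oc h'.
  rewrite -[LHS]mcomp_idl e1 !mcompDl -!mcompA -hE (mcompA s) e2.
  rewrite mcompDl -!mcompA -addrA addrACA /x /h' !mcompDr.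
  by congr (_ + _); exact: addrC.
have gbx : g2 \oc (b \oc x) = 0.
  have := hclass_cycle dy; rewrite dE mcompDr [X in _ + X]mcompA.
  by rewrite gf2 mcomp0l addr0.
(* [c] sends [g1 \oc x] to [g2 \oc (b \oc x) = 0], and [p] undoes [c] on the image of [g1]. *)
have gx : g1 \oc x = 0.
  by rewrite -e3 -mcompA -(mcompA p) (mcompA c) bc -!mcompA gbx mcomp0r.
have [u uE] := hclass_exists gf1 gx.
exists P', (q \oc q'), u; split; first exact: is_epi_comp.
apply: (@hclass_inj _ _ _ _ _ _ _ d'); last by rewrite mcompA.
rewrite dE -[_ \oc u]addr0; apply: hclassD; first exact: hclass_map.
exact: hclass_boundary.
Qed.

End ExactMaps.

End Abelian.

(** * Zeroth homology of maps of complexes: only degree 0 matters *)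

Section ZerothHomology.
Variable A : abelian.
Implicit Types K L M : complex A.

Lemma H0_map_homotopic K L (u v : complex_mor K L)
    (z : Hom (K (0 + 1)) (L 0)) (s : Hom (K 0) (L (- 1))) :
  cm u 0 = cm v 0 + (z \oc cd K 0 + (cd L (- 1) : Hom _ (L 0)) \oc s) ->
  H0_map u = H0_map v.
Proof. exact: homology_map_homotopic. Qed.

Lemma H0_map_idm K (u : complex_mor K K) :
  cm u 0 = idm (K 0) -> H0_map u = idm (H0 K).
Proof.
move=> u1; apply: homology_ext => W c y cy.
have uy := hclass_map (cd_cd K (- 1)) (cm_cd u (- 1)) (cm_cd u 0) cy.
by apply: (hclass_inj uy); rewrite u1 !mcomp_idl.
Qed.

Lemma H0_map_comp K L M (v : complex_mor L M) (u : complex_mor K L)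
    (t : complex_mor K M) :
  cm t 0 = cm v 0 \oc cm u 0 -> H0_map t = H0_map v \oc H0_map u.
Proof.
move=> tE; apply: homology_ext => W c y cy.
have ty := hclass_map (cd_cd M (- 1)) (cm_cd t (- 1)) (cm_cd t 0) cy.
apply: (hclass_inj ty); rewrite tE -!mcompA.
exact/hclass_map/hclass_map.
Qed.

Lemma H0_mapD K L (u v t : complex_mor K L) :
  cm t 0 = cm u 0 + cm v 0 -> H0_map t = H0_map u + H0_map v.
Proof.
move=> tE; apply: homology_ext => W c y cy.
have ty := hclass_map (cd_cd L (- 1)) (cm_cd t (- 1)) (cm_cd t 0) cy.
apply: (hclass_inj ty); rewrite tE !mcompDl.
by apply: hclassD; exact: hclass_map.
Qed.

End ZerothHomology.

Lemma fmapN (C D : preadditive) (F : additive_functor C D) (X Y : C)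
    (f : Hom X Y) : fmap F (- f) = - fmap F f.
Proof. by apply: (addrI (fmap F f)); rewrite -fmapD !subrr fmap0. Qed.

(** Choice with a prescribed value at one index, for families of truncations fixed in one degree
    only. *)
Lemma dep_choice_at (I : Type) (T : I -> Type) (P : forall n, T n -> Prop) i
    (x : T i) : P i x -> (forall n, exists y, P n y) ->
  exists L : forall n, T n, (forall n, P n (L n)) /\ L i = x.
Proof.
move=> Px exP.
have E n : exists y : T n, P n y /\ forall e : i = n, y = eq_rect i T x n e.
  case: (pselect (i = n)) => [<-|ne].
    by exists x; split=> // e; rewrite (Prop_irrelevance e erefl).
  by have [y Py] := exP n; exists y; split=> // e; case: ne.
exists (fun n => projT1 (cid (E n))); split=> [n|]; case: cid => y [] //= Py.
by move=> /(_ erefl).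
Qed.

(** * Complements on distinguished triangles *)

Section Triangles.
Variable C : triangulated.
Implicit Types X Y Z W N : C.

Definition shVsh X : Hom (shV (sh X)) X := sh_unit X.

Lemma shVsh_natural X Y (f : Hom X Y) :
  shVsh Y \oc fmap shV (fmap sh f) = f \oc shVsh X.
Proof. exact: (nt_natural (@sh_unit C)). Qed.

Lemma dist_rot X Y Z (f : Hom X Y) (g : Hom Y Z) (h : Hom Z (sh X)) :
  dist f g h -> dist g h (- fmap sh f).
Proof. by move/dist_rotate. Qed.

Lemma dist_lift_sh X Y Z (f : Hom X Y) (g : Hom Y Z) (h : Hom Z (sh X))
    W (u : Hom W X) :
  dist f g h -> f \oc u = 0 -> exists v, h \oc v = fmap sh u.
Proof.
move=> /dist_rot/dist_rot d fu; apply: (dist_lift d).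
by rewrite mcompNl -fmapM fu fmap0 oppr0.
Qed.

Lemma dist_cocone Y R (r : Hom Y R) :
  exists (L : C) (f : Hom L Y) (h : Hom R (sh L)), dist f r h.
Proof.
have [W [k1 [k2 d]]] := dist_cone r.
have [b [b' [b'b bb']]] := shshV_iso W.
have [f fE] := sh_full (k2 \oc b).
(* The sign of [- f] cancels the one introduced by rotation. *)
exists (shV W), (- f), (b' \oc k1); apply/dist_rotate.
rewrite fmapN opprK fE.
have b'i : is_iso b' by exists b.
apply: dist_iso (iso1 Y) (iso1 R) b'i d; split.
- by rewrite mcomp_idl mcomp_idr.
- by rewrite mcomp_idr.
- by rewrite fmap1 mcomp_idl -mcompA bb' mcomp_idr.
Qed.

End Triangles.

(** * Truncations and the terms of the weight complex *)

Section Truncations.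
Variables (C : triangulated) (w : weight_structure C).
Implicit Types X Y Z M N : C.
Implicit Types i k : int.

Section Object.
Variables (M : C) (D : weight_data w M).

(** The ambiguity of a lift comes from maps N[1] -> w_{>=i+1}M, which vanish since N[1] lies in
    C_{w<=i}. *)
Lemma wle_lift_eq0 i N (x : Hom N (wle D i)) :
  w_le w (i - 1) N -> wh D i \oc x = 0 -> x = 0.
Proof.
move=> Nw hx; have [v vE] := dist_lift_sh (w_dist D i) hx.
apply: sh_faithful; rewrite fmap0 -vE (_ : v = 0) ?mcomp0r //.
by apply: w_orth (wge_ge D _); rewrite -{1}(subrK 1 i); apply: w_le_sh.
Qed.

Lemma shifted_wle i : w_le w i (sh (wle D (i - 1))).
Proof. by rewrite -{1}(subrK 1 i); apply/w_le_sh/wle_le. Qed.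

(** The octahedron on h_k j_{k-1} = h_{k-1} gives a triangle M_k -> w_{>=k}M -> w_{>=k+1}M; w_{>=k}M
    appears as [wge D (k - 1 + 1)], the index carried by [wr D (k - 1)]. *)
Lemma wM_wge_exists k :
  exists (u : Hom (wM D k) (wge D (k - 1 + 1)))
      (v : Hom (wge D (k - 1 + 1)) (wge D (k + 1))),
    [/\ dist u v (fmap sh (wa D k) \oc wd D k),
        u \oc wa D k = wr D (k - 1) \oc wh D k & wd D (k - 1) \oc u = wb D k].
Proof.
have d := w_dist D (k - 1); rewrite -wh_wj in d.
have [u [v [duv ua du _ _]]] := dist_octahedral (wM_dist D k) (w_dist D k) d.
by exists u, v.
Qed.

Definition wM_wge k : Hom (wM D k) (wge D (k - 1 + 1)) :=
  projT1 (cid (wM_wge_exists k)).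

Lemma wM_wgeP k : exists v : Hom (wge D (k - 1 + 1)) (wge D (k + 1)),
  [/\ dist (wM_wge k) v (fmap sh (wa D k) \oc wd D k),
      wM_wge k \oc wa D k = wr D (k - 1) \oc wh D k
    & wd D (k - 1) \oc wM_wge k = wb D k].
Proof. exact: projT2 (cid (wM_wge_exists k)). Qed.

Lemma wM_wge_lift k N (x : Hom N (wge D (k - 1 + 1))) :
  w_le w k N -> exists y, wM_wge k \oc y = x.
Proof.
move=> Nw; have [v [d _ _]] := wM_wgeP k.
by apply: (dist_lift d); apply: w_orth Nw (wge_ge D _).
Qed.

(* The differential of the weight complex in degree -k, shifted by [k-1]. *)
Definition wM_boundaryV k : Hom (shV (wM D k)) (wM D (k - 1)) :=
  shVsh _ \oc fmap shV (wM_boundary D k).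

Lemma wM_boundaryV_lift k N (x : Hom N (wM D (k - 1))) y :
  fmap sh x = wM_boundary D k \oc y -> exists s, x = wM_boundaryV k \oc s.
Proof.
move=> xy; have [n [_ nE]] := sh_unit_iso N.
exists (fmap shV y \oc n).
by rewrite -[x]mcomp_idr -nE mcompA -[x \oc _]shVsh_natural xy fmapM !mcompA.
Qed.

(** By the triangle M_{k-1} -> w_{>=k-1}M -> w_{>=k}M, the shift of [x] comes from a map N[1] ->
    w_{>=k}M. As N[1] lies in C_{w<=k}, that map lifts to M_k, and M_k -> w_{>=k}M -> M_{k-1}[1] is
    the boundary. *)
Lemma wM_boundary_exact k N (x : Hom N (wM D (k - 1))) :
  w_le w (k - 1) N -> wM_wge (k - 1) \oc x = 0 ->
  exists s, x = wM_boundaryV k \oc s.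
Proof.
move=> Nw ux; have [v [d _ _]] := wM_wgeP (k - 1).
have [y yE] := dist_lift_sh d ux.
have Nw1 : w_le w k (sh N) by rewrite -(subrK 1 k); apply: w_le_sh.
have [s sE] := wM_wge_lift y Nw1; have [_ [_ _ us]] := wM_wgeP k.
apply: (@wM_boundaryV_lift _ _ _ s).
by rewrite -yE -sE -mcompA (mcompA (wd D _)) us mcompA.
Qed.

(** The map w_{<=k-1}M -> M_{k-1} -> w_{>=k-1}M factors through [wj D k], whose shift kills
    [wb D k]. *)
Lemma wM_wge_boundaryV k : wM_wge (k - 1) \oc wM_boundaryV k = 0.
Proof.
have [_ [_ ua _]] := wM_wgeP (k - 1).
have bj : fmap sh (wj D k) \oc wb D k = 0.
  have := dist_comp0 (dist_rot (dist_rot (wM_dist D k))).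
  by rewrite mcompNl => /eqP; rewrite oppr_eq0 => /eqP.
have uw : fmap sh (wM_wge (k - 1)) \oc wM_boundary D k = 0.
  by rewrite /wM_boundary mcompA -fmapM ua -wh_wj !fmapM -!mcompA bj !mcomp0r.
by rewrite /wM_boundaryV mcompA -shVsh_natural -mcompA -fmapM uw fmap0 mcomp0r.
Qed.

End Object.

(** * Extensions of a morphism to weight data *)

Section Extensions.
Variables (M M' : C) (D : weight_data w M) (D' : weight_data w M').

(* The two terms form a weak homotopy: unlike in a homotopy, [z] and [s] do not
   come from a common family of maps, but the induced map on homology in this
   degree still vanishes. *)
Lemma mM_weak_homotopy (e : weight_data_mor (0 : Hom M M') D D') k :
  exists (z : Hom (sh (wM D (k - 1 - 1))) (wM D' (k - 1)))
      (s : Hom (wM D (k - 1)) (shV (wM D' k))),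
    mM e (k - 1) = z \oc wM_boundary D (k - 1) + wM_boundaryV D' k \oc s.
Proof.
have hl i : wh D' i \oc ml e i = 0.
  by have [+ _ _] := ml_mr_tri e i; rewrite mcomp0l.
have [_ ma _] := mM_tri e (k - 1).
have Lw i : w_le w i (wle D i) by exact: wle_le.
(* Each [ml e i] lifts 0, so it dies once its source is one weight lower or its target one weight
   higher. *)
have lj : ml e (k - 1) \oc wj D (k - 1) = 0.
  by apply: (wle_lift_eq0 (Lw _)); rewrite mcompA hl mcomp0l.
have [x xE] := dist_colift (wM_dist D (k - 1)) lj.
have jl : wj D' k \oc ml e (k - 1) = 0.
  by apply: (wle_lift_eq0 (Lw _)); rewrite mcompA wh_wj hl.
have jxa : wj D' k \oc x \oc wa D (k - 1) = 0 by rewrite -mcompA xE.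
(* Correct [x] to [x0] without changing its composite with [wa], so that [wj D' k] kills it; then
   [wa D' (k - 1) \oc x0] factors through the boundary into M'_{k-1}. *)
have [q qE] := dist_colift (dist_rot (wM_dist D (k - 1))) jxa.
have aq : wa D' k \oc q = 0.
  apply: (w_orth _ (shifted_wle D (k - 1))); rewrite subrK; exact: wM_ge.
have [q' q'E] := dist_lift (wM_dist D' k) aq.
pose x0 := x - q' \oc wb D (k - 1).
have jx0 : wj D' k \oc x0 = 0 by rewrite mcompBr mcompA q'E qE subrr.
have ba := dist_comp0 (dist_rot (wM_dist D (k - 1))).
have x0a : x0 \oc wa D (k - 1) = ml e (k - 1).
  by rewrite mcompBl -mcompA ba mcomp0r subr0.
(* The remainder factors through [wb], and by orthogonality further through the boundary out of
   M_{k-1}. *)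
have ya : (mM e (k - 1) - wa D' (k - 1) \oc x0) \oc wa D (k - 1) = 0.
  by rewrite mcompBl ma -mcompA x0a subrr.
have [y yE] := dist_colift (dist_rot (wM_dist D (k - 1))) ya.
have yj : y \oc fmap sh (wj D (k - 1 - 1)) = 0.
  apply: (@w_orth _ w (k - 1 - 1)); first exact: shifted_wle.
  rewrite subrK; exact: wM_ge.
have [z zE] := dist_colift (sh_dist (wM_dist D (k - 1 - 1))) yj.
have [v vE] := dist_lift_sh (wM_dist D' k) jx0.
have [s sE] : exists s, wa D' (k - 1) \oc x0 = wM_boundaryV D' k \oc s.
  by apply: (@wM_boundaryV_lift _ _ _ _ _ v); rewrite fmapM -vE mcompA.
by exists z, s; rewrite -sE mcompA zE yE subrK.
Qed.

(* A filler m0 of the triangles defining M_k and M'_k need not commute with the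
   maps to w_{>=k}; the defect factors through w_{<=k-1}M[1], hence lifts to
   M'_k by orthogonality and can be subtracted. *)
Lemma mM_filler (g : Hom M M') k (l1 : Hom (wle D (k - 1)) (wle D' (k - 1)))
    (l : Hom (wle D k) (wle D' k))
    (r : Hom (wge D (k - 1 + 1)) (wge D' (k - 1 + 1))) :
  is_tri_mor (wh D (k - 1)) (wr D (k - 1)) (wd D (k - 1))
    (wh D' (k - 1)) (wr D' (k - 1)) (wd D' (k - 1)) l1 g r ->
  g \oc wh D k = wh D' k \oc l ->
  exists m, is_tri_mor (wj D k) (wa D k) (wb D k)
    (wj D' k) (wa D' k) (wb D' k) l1 l m /\
    r \oc wM_wge D k = wM_wge D' k \oc m.
Proof.
move=> [hl1 rr dr] hl.
have jE : l \oc wj D k = wj D' k \oc l1.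
  apply/eqP; rewrite -subr_eq0; apply/eqP.
  apply: (wle_lift_eq0 (wle_le D _)).
  by rewrite mcompBr !mcompA -hl -mcompA !wh_wj hl1 subrr.
have [m0 [_ m0a m0b]] := dist_fill (wM_dist D k) (wM_dist D' k) jE.
have [v [_ ua du]] := wM_wgeP D k; have [v' [d' ua' du']] := wM_wgeP D' k.
have ba := dist_comp0 (dist_rot (wM_dist D k)).
pose eps := r \oc wM_wge D k - wM_wge D' k \oc m0.
have epsa : eps \oc wa D k = 0.
  rewrite mcompBl -!mcompA ua m0a !mcompA ua' rr -!mcompA hl.
  by rewrite subrr.
have [kap kapE] := dist_colift (dist_rot (wM_dist D k)) epsa.
have vkap : v' \oc kap = 0.
  apply: (@w_orth _ w k); [exact: shifted_wle|exact: wge_ge].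
have [zeta zetaE] := dist_lift d' vkap.
(* The correction preserves the square with [wb]: this map factors through w_{>=k}M', and the defect
   dies in w_{<=k-1}M'[1]. *)
have bzb : wb D' k \oc (zeta \oc wb D k) = 0.
  rewrite -du' -mcompA (mcompA _ zeta) zetaE kapE mcompBr !mcompA -dr.
  by rewrite du' -m0b -mcompA du subrr.
exists (m0 + zeta \oc wb D k); split; last first.
  by rewrite mcompDr mcompA zetaE kapE [RHS]addrC [RHS]subrK.
split=> //.
  by rewrite mcompDl -mcompA ba mcomp0r addr0.
by rewrite mcompDr bzb addr0.
Qed.

(** Truncations at different indices can be extended independently; [mM_filler] then supplies the
    maps on all M_k. *)
Lemma weight_data_mor_at (g : Hom M M') i (l : Hom (wle D i) (wle D' i))
    (r : Hom (wge D (i + 1)) (wge D' (i + 1))) :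
  is_tri_mor (wh D i) (wr D i) (wd D i) (wh D' i) (wr D' i) (wd D' i) l g r ->
  exists e : weight_data_mor g D D', [/\ ml e i = l, mr e i = r
    & forall k, mr e (k - 1) \oc wM_wge D k = wM_wge D' k \oc mM e k].
Proof.
move=> lr; have [e0 _] := weight_data_mor_exists g D D'.
pose T n := (Hom (wle D n) (wle D' n) *
  Hom (wge D (n + 1)) (wge D' (n + 1)))%type.
pose P n (t : T n) := is_tri_mor (wh D n) (wr D n) (wd D n)
  (wh D' n) (wr D' n) (wd D' n) t.1 g t.2.
have [|L [LP Li]] := @dep_choice_at _ T P i (l, r) lr.
  by move=> n; exists (ml e0 n, mr e0 n); exact: ml_mr_tri.
have mP k : exists m, _ :=
  mM_filler (LP (k - 1)) (let: And3 p _ _ := LP k in p).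
pose m k := projT1 (cid (mP k)).
have mE k := projT2 (cid (mP k)).
exists (WeightDataMor LP (fun k => (mE k).1)); split=> /=; rewrite ?Li //.
by move=> k; exact: (mE k).2.
Qed.

End Extensions.

(** * Splicing weight decompositions along a triangle *)

Section Splice.
Variables (X Y Z : C) (f : Hom X Y) (g : Hom Y Z) (i : int)
  (Lx Rx : C) (hx : Hom Lx X) (rx : Hom X Rx) (dx : Hom Rx (sh Lx))
  (Lz Rz : C) (hz : Hom Lz Z) (rz : Hom Z Rz) (dz : Hom Rz (sh Lz)).

(** A 3x3 diagram of triangles; the one on [Lx], [L], [Lz] is recorded in rotated form, starting at
    its connecting map [dl]. *)
Definition spliced (L R : C) (h : Hom L Y) (r : Hom Y R) (d : Hom R (sh L)) :
    Prop :=
  exists (lf : Hom Lx L) (lg : Hom L Lz) (rf : Hom Rx R) (rg : Hom R Rz)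
      (dl : Hom Lz (sh Lx)) (dr : Hom Rz (sh Rx)),
    [/\ is_tri_mor hx rx dx h r d lf f rf, is_tri_mor h r d hz rz dz lg g rg,
        dist dl (fmap sh lf) (fmap sh lg) & dist rf rg dr].

(** Orthogonality lifts Lz -> Z to [m : Lz -> Y']. Three octahedra then exhibit Y' as an extension
    of Z by Rx, the cone R of [m] as one of Rz by Rx, and the cocone L of Y -> R as one of Lz by
    Lx. *)
Lemma splice (h : Hom Z (sh X)) :
  dist f g h -> dist hx rx dx -> dist hz rz dz ->
  w_le w i Lx -> w_ge w (i + 1) Rx -> w_le w i Lz -> w_ge w (i + 1) Rz ->
  exists (L R : C) (hy : Hom L Y) (ry : Hom Y R) (dy : Hom R (sh L)),
    [/\ w_le w i L, w_ge w (i + 1) R, dist hy ry dy & spliced hy ry dy].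
Proof.
move=> dfgh dX dZ Lxw Rxw Lzw Rzw.
(* Y' is Y / Lx, an extension of Z by Rx. *)
have [Y' [k1 [k2 dY']]] := dist_cone (f \oc hx).
have [u1 [v1 [d1 u1rx k2u1 v1k1 hv1]]] := dist_octahedral dX dfgh dY'.
have Lz0 : (fmap sh rx \oc h) \oc hz = 0.
  exact: (w_orth _ Lzw (w_ge_sh (w_ge_pred Rxw))).
have [m mE] := dist_lift (dist_rot d1) Lz0.
have [R [k [f2 dm]]] := dist_cone m.
have dvm : dist (v1 \oc m) rz dz by rewrite mE.
have [u2 [v2 [d2 u2k dzu2 v2rz v2m]]] := dist_octahedral dm (dist_rot d1) dvm.
have dR : dist (k \oc u1) u2 v2.
  by apply/dist_rotate; rewrite fmapM -mcompNr.
have [L [hy [dy dY]]] := dist_cocone (k \oc k1).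
have dk1 := dist_rot dY'.
have [u3 [v3 [d3 u3k2 hu3 v3dy mv3]]] :=
  dist_octahedral dk1 (dist_rot dm) (dist_rot dY).
have [lf lfE] := sh_full u3; have [lg lgE] := sh_full v3.
have dL : dist (k2 \oc m) (fmap sh lf) (fmap sh lg).
  by apply/dist_rotate; rewrite lfE lgE fmapM -mcompNr.
have fmor : is_tri_mor hx rx dx hy (k \oc k1) dy lf f (k \oc u1).
  split; last by rewrite lfE -k2u1 !mcompA u3k2.
    apply: sh_faithful; apply: oppr_inj.
    by rewrite -hu3 -lfE !fmapM mcompNl.
  by rewrite -!mcompA u1rx.
have gmor : is_tri_mor hy (k \oc k1) dy hz rz dz lg g u2.
  split; last by rewrite lgE v3dy.
    rewrite -lgE mcompNl mcompNr -!fmapM in mv3.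
    by rewrite -mE -v1k1 -!mcompA (sh_faithful (oppr_inj mv3)).
  by rewrite mcompA u2k -!mcompA v1k1.
exists L, R, hy, (k \oc k1), dy; split=> //; last first.
- by exists lf, lg, (k \oc u1), u2, (k2 \oc m), v2.
(* Both classes are characterized by orthogonality, hence closed under extensions. *)
- apply: w_ge_orth => T x; rewrite addrK => Tw.
  have ux : u2 \oc x = 0 by apply: (w_orth _ Tw).
  have [y <-] := dist_lift dR ux.
  by rewrite (w_orth y Tw Rxw) mcomp0r.
- apply: w_le_orth => T x Tw.
  have xlf : fmap sh x \oc fmap sh lf = 0.
    by rewrite -fmapM (w_orth (x \oc lf) Lxw Tw) fmap0.
  have [y yE] := dist_colift (dist_rot dL) xlf.
  apply: sh_faithful; rewrite -yE fmap0.
  by rewrite (w_orth y (w_le_sh Lzw) (w_ge_sh Tw)) mcomp0l.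
Qed.

End Splice.

(** The given triangle is prescribed through a predicate [P], not an equality, since its third
    object is met again only up to [i + 1 - 1 = i]. *)
Lemma weight_data_at M i
    (P : forall L R : C, Hom L M -> Hom M R -> Hom R (sh L) -> Prop) :
  (exists (L R : C) (f : Hom L M) (g : Hom M R) (h : Hom R (sh L)),
    [/\ w_le w i L, w_ge w (i + 1) R, dist f g h & P _ _ f g h]) ->
  exists D : weight_data w M, P _ _ (wh D i) (wr D i) (wd D i).
Proof.
case=> [L0 [R0 [f0 [g0 [h0 [L0w R0w d0 P0]]]]]].
pose T (n : int) := {L : C & {R : C & Hom L M * Hom M R * Hom R (sh L)}}%type.
pose Q n (t : T n) := let: existT L (existT R (f, g, h)) := t in
  [/\ w_le w n L, w_ge w (n + 1) R & dist f g h].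
have [||t [tQ ti]] :=
  @dep_choice_at _ T Q i (existT _ L0 (existT _ R0 (f0, g0, h0))).
- by [].
- move=> n; have [L [R [f [g [h H]]]]] := w_decomposable_all w n M.
  by exists (existT _ L (existT _ R (f, g, h))).
pose L n := projT1 (t n).
pose R n := projT1 (projT2 (t (n - 1))).
have dP n : exists s : Hom (L n) M * Hom M (R (n + 1)) *
    Hom (R (n + 1)) (sh (L n)),
    dist s.1.1 s.1.2 s.2 /\ (n = i -> P _ _ s.1.1 s.1.2 s.2).
  rewrite /R addrK /L.
  have [->|ne] := eqVneq n i; first by rewrite ti; exists (f0, g0, h0).
  have := tQ n; case: (t n) => L1 [R1 [[f g] h]] [_ _ d] /=.
  by exists (f, g, h); split=> // ni; rewrite ni eqxx in ne.
have Lw n : w_le w n (L n).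
  by have := tQ n; rewrite /L; case: (t n) => L1 [R1 [[f g] h]] [].
have Rw n : w_ge w n (R n).
  have := tQ (n - 1); rewrite /R; case: (t _) => L1 [R1 [[f g] h]] [_ + _] /=.
  by rewrite subrK.
pose d n := projT1 (cid (dP n)).
have dE n : dist (d n).1.1 (d n).1.2 (d n).2 := (projT2 (cid (dP n))).1.
have dPi : P _ _ (d i).1.1 (d i).1.2 (d i).2 := (projT2 (cid (dP i))).2 erefl.
have jP n : exists j : Hom (L (n - 1)) (L n), (d n).1.1 \oc j = (d (n - 1)).1.1.
  apply: (dist_lift (dE n)); apply: (@w_orth _ w n) => //; exact: w_le_succ.
pose j n := projT1 (cid (jP n)).
have jE n : (d n).1.1 \oc j n = (d (n - 1)).1.1 := projT2 (cid (jP n)).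
have cP n : exists s : {N : C & Hom (L n) N * Hom N (sh (L (n - 1)))}%type,
    dist (j n) (projT2 s).1 (projT2 s).2.
  by have [N [a [b H]]] := dist_cone (j n); exists (existT _ N (a, b)).
pose c n := projT1 (cid (cP n)).
have cE n : dist (j n) (projT2 (c n)).1 (projT2 (c n)).2 :=
  projT2 (cid (cP n)).
by exists (@WeightData C w M L R (fun n => (d n).1.1) (fun n => (d n).1.2)
  (fun n => (d n).2) Lw Rw dE j jE (fun n => projT1 (c n))
  (fun n => (projT2 (c n)).1) (fun n => (projT2 (c n)).2) cE).
Qed.

(** * Splitting up to boundaries in one degree *)

Section Exactness.
Variables (X Y Z : C) (f : Hom X Y) (g : Hom Y Z).
Variables (DX : weight_data w X) (DY : weight_data w Y) (DZ : weight_data w Z).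
Variables (ef : weight_data_mor f DX DY) (eg : weight_data_mor g DY DZ).
Variable k : int.

(** By orthogonality [wa DX (k - 1)] extends along w_{<=k-1}X -> w_{<=k-1}Y, and the extension kills
    [wj DY (k - 1)], so it descends to Y_{k-1}. The boundary factors through the shift of
    [wa DX (k - 1)]. *)
Lemma mM_retraction (dl : Hom (wle DZ (k - 1)) (sh (wle DX (k - 1)))) :
  dist dl (fmap sh (ml ef (k - 1))) (fmap sh (ml eg (k - 1))) ->
  exists p, p \oc fmap sh (mM ef (k - 1)) \oc wM_boundary DX k =
    wM_boundary DX k.
Proof.
move=> dL; have [_ ma _] := mM_tri ef (k - 1).
have Xge : w_ge w (k - 1) (wM DX (k - 1)) by exact: wM_ge.
have a0 : fmap sh (wa DX (k - 1)) \oc dl = 0.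
  by apply: (w_orth _ (wle_le DZ _)); exact: w_ge_sh.
have [nu1 nu1E] := dist_colift dL a0; have [nu nuE] := sh_full nu1.
rewrite -nuE -fmapM in nu1E; have {nuE}nul := sh_faithful nu1E.
have nuj : nu \oc wj DY (k - 1) = 0.
  apply: (@w_orth _ w (k - 1 - 1)); first exact: wle_le.
  by rewrite subrK.
have [p pa] := dist_colift (wM_dist DY (k - 1)) nuj.
exists (fmap sh p); rewrite /wM_boundary mcompA -fmapM -fmapM -mcompA ma mcompA.
by rewrite pa nul.
Qed.

Hypothesis ef_wge :
  mr ef (k - 1 - 1) \oc wM_wge DX (k - 1) = wM_wge DY (k - 1) \oc mM ef (k - 1).
Hypothesis eg_wge :
  mr eg (k - 1 - 1) \oc wM_wge DY (k - 1) = wM_wge DZ (k - 1) \oc mM eg (k - 1).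
Variable dr : Hom (wge DZ (k - 1 - 1 + 1)) (sh (wge DX (k - 1 - 1 + 1))).
Hypothesis dist_wge : dist (mr ef (k - 1 - 1)) (mr eg (k - 1 - 1)) dr.

(* Modulo boundaries, Hom(N, M_{k-1}) is Hom(N, w_{>=k-1}M). *)
Lemma mM_exact_mod_boundary N (x : Hom N (wM DY (k - 1))) :
  w_le w (k - 1) N -> wM_wge DZ (k - 1) \oc (mM eg (k - 1) \oc x) = 0 ->
  exists r t, x = mM ef (k - 1) \oc r + wM_boundaryV DY k \oc t.
Proof.
move=> Nw; rewrite mcompA -eg_wge -mcompA => gx.
have [chi chiE] := dist_lift dist_wge gx.
have [r rE] := wM_wge_lift chi Nw.
have [|t tE] := @wM_boundary_exact _ DY k _ (x - mM ef (k - 1) \oc r) Nw.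
  by rewrite mcompBr [_ \oc (_ \oc r)]mcompA -ef_wge -mcompA rE chiE subrr.
by exists r, t; rewrite -tE [RHS]addrC [RHS]subrK.
Qed.

(** By orthogonality Z_{k-1} -> w_{>=k-1}Z lifts to w_{>=k-1}Y and then to [s], a section of
    [mM eg (k - 1)] after mapping to w_{>=k-1}Z. Exactness modulo boundaries applies to
    [idm _ - s \oc mM eg (k - 1)] and to [s \oc wM_boundaryV DZ k]. *)
Lemma mM_split_mod_boundary : exists s r t r' t',
  idm (wM DY (k - 1)) = s \oc mM eg (k - 1) + mM ef (k - 1) \oc r +
    wM_boundaryV DY k \oc t /\
  s \oc wM_boundaryV DZ k = mM ef (k - 1) \oc r' + wM_boundaryV DY k \oc t'.
Proof.
have u0 : dr \oc wM_wge DZ (k - 1) = 0.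
  apply: (w_orth _ (wM_le DZ _)); apply: w_ge_sh.
  by rewrite -{1}(subrK 1 (k - 1)); exact: wge_ge.
have [psi psiE] := dist_lift (dist_rot dist_wge) u0.
have [s sE] := wM_wge_lift psi (wM_le DZ (k - 1)).
have us : wM_wge DZ (k - 1) \oc (mM eg (k - 1) \oc s) = wM_wge DZ (k - 1).
  by rewrite mcompA -eg_wge -mcompA sE.
have [|r [t rt]] :=
  @mM_exact_mod_boundary _ (idm _ - s \oc mM eg (k - 1)) (wM_le DY _).
  rewrite mcompBr mcomp_idr [mM _ _ \oc (s \oc _)]mcompA mcompBr.
  by rewrite (mcompA (wM_wge DZ _)) us subrr.
have [|r' [t' rt']] := @mM_exact_mod_boundary _ (s \oc wM_boundaryV DZ k)
    (w_le_shV (wM_le DZ k)).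
  by rewrite (mcompA (mM eg _)) (mcompA (wM_wge DZ _)) us wM_wge_boundaryV.
by exists s, r, t, r', t'; rewrite -addrA -rt [RHS]addrC [RHS]subrK.
Qed.

End Exactness.

Lemma exact_weight_data (X Y Z : C) (f : Hom X Y) (g : Hom Y Z)
    (h : Hom Z (sh X)) (DX : weight_data w X) (DZ : weight_data w Z) k :
  dist f g h ->
  exists (DY : weight_data w Y) (ef : weight_data_mor f DX DY)
      (eg : weight_data_mor g DY DZ) s r t r' t' p,
    [/\ idm (wM DY (k - 1)) = s \oc mM eg (k - 1) + mM ef (k - 1) \oc r +
          wM_boundaryV DY k \oc t,
        s \oc wM_boundaryV DZ k =
          mM ef (k - 1) \oc r' + wM_boundaryV DY k \oc t'
      & p \oc fmap sh (mM ef (k - 1 - 1)) \oc wM_boundary DX (k - 1) =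
          wM_boundary DX (k - 1)].
Proof.
(* At this cut w_{>=i+1} yields the first two identities and w_{<=i} the third. *)
move=> dfgh; set i := k - 1 - 1.
have [DY [lf [lg [rf [rg [dl [dr [fm gm dL dR]]]]]]]] :=
  weight_data_at (splice dfgh (w_dist DX i) (w_dist DZ i)
    (wle_le DX i) (wge_ge DX _) (wle_le DZ i) (wge_ge DZ _)).
have [ef [efl efr efu]] := weight_data_mor_at fm.
have [eg [egl egr egu]] := weight_data_mor_at gm.
rewrite -efl -egl in dL; rewrite -efr -egr in dR.
have [p pE] := mM_retraction dL.
have [s [r [t [r' [t' [e1 e2]]]]]] :=
  mM_split_mod_boundary (efu _) (egu _) dR.
by exists DY, ef, eg, s, r, t, r', t', p.
Qed.

End Truncations.

(** * Algebra of morphisms of triangles *)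

Section TriangleMorphisms.
Variables (C : shifted_category) (X Y Z X' Y' Z' X'' Y'' Z'' : C).
Variables (f : Hom X Y) (g : Hom Y Z) (h : Hom Z (sh X)).
Variables (f' : Hom X' Y') (g' : Hom Y' Z') (h' : Hom Z' (sh X')).
Variables (f'' : Hom X'' Y'') (g'' : Hom Y'' Z'') (h'' : Hom Z'' (sh X'')).

Lemma is_tri_mor_idm : is_tri_mor f g h f g h (idm X) (idm Y) (idm Z).
Proof. by split; rewrite ?fmap1 mcomp_idl mcomp_idr. Qed.

Lemma is_tri_mor_comp a b c a' b' c' :
  is_tri_mor f g h f' g' h' a b c -> is_tri_mor f' g' h' f'' g'' h'' a' b' c' ->
  is_tri_mor f g h f'' g'' h'' (a' \oc a) (b' \oc b) (c' \oc c).
Proof.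
move=> [ab bc ca] [ab' bc' ca']; split.
- by rewrite -mcompA ab !mcompA ab'.
- by rewrite -mcompA bc !mcompA bc'.
- by rewrite fmapM -mcompA ca !mcompA ca'.
Qed.

Lemma is_tri_morD a b c a1 b1 c1 :
  is_tri_mor f g h f' g' h' a b c -> is_tri_mor f g h f' g' h' a1 b1 c1 ->
  is_tri_mor f g h f' g' h' (a + a1) (b + b1) (c + c1).
Proof.
by move=> [ab bc ca] [ab1 bc1 ca1];
  split; rewrite ?fmapD mcompDl mcompDr ?(ab, bc, ca) ?(ab1, bc1, ca1).
Qed.

Lemma is_tri_morN a b c :
  is_tri_mor f g h f' g' h' a b c ->
  is_tri_mor f g h f' g' h' (- a) (- b) (- c).
Proof.
by move=> [ab bc ca]; split; rewrite ?fmapN mcompNl mcompNr ?(ab, bc, ca).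
Qed.

End TriangleMorphisms.

(** * Algebra of morphisms of weight data *)

Section WeightDataMorphisms.
Variables (C : triangulated) (w : weight_structure C).

Definition weight_data_idm (M : C) (D : weight_data w M) :
    weight_data_mor (idm M) D D :=
  @WeightDataMor C w M M (idm M) D D (fun i => idm _) (fun i => idm _)
    (fun i => idm _) (fun i => is_tri_mor_idm _ _ _)
    (fun i => is_tri_mor_idm _ _ _).

Definition weight_data_comp (M N P : C) (D : weight_data w M)
    (D' : weight_data w N) (D'' : weight_data w P) (g : Hom N P) (f : Hom M N)
    (e' : weight_data_mor g D' D'') (e : weight_data_mor f D D') :
    weight_data_mor (g \oc f) D D'' :=
  @WeightDataMor C w M P (g \oc f) D D'' (fun i => ml e' i \oc ml e i)
    (fun i => mr e' i \oc mr e i) (fun i => mM e' i \oc mM e i)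
    (fun i => is_tri_mor_comp (ml_mr_tri e i) (ml_mr_tri e' i))
    (fun i => is_tri_mor_comp (mM_tri e i) (mM_tri e' i)).

Section Additive.
Variables (M N : C) (D : weight_data w M) (D' : weight_data w N).

Definition weight_data_add (g g' : Hom M N) (e : weight_data_mor g D D')
    (e' : weight_data_mor g' D D') : weight_data_mor (g + g') D D' :=
  @WeightDataMor C w M N (g + g') D D' (fun i => ml e i + ml e' i)
    (fun i => mr e i + mr e' i) (fun i => mM e i + mM e' i)
    (fun i => is_tri_morD (ml_mr_tri e i) (ml_mr_tri e' i))
    (fun i => is_tri_morD (mM_tri e i) (mM_tri e' i)).

Lemma weight_data_sub (g : Hom M N) (e e' : weight_data_mor g D D') :
  exists d : weight_data_mor (0 : Hom M N) D D',
    forall k, mM d k = mM e k - mM e' k.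
Proof.
have lrP i : is_tri_mor (wh D i) (wr D i) (wd D i) (wh D' i) (wr D' i) (wd D' i)
    (ml e i - ml e' i) 0 (mr e i - mr e' i).
  rewrite -(subrr g).
  exact: is_tri_morD (ml_mr_tri e i) (is_tri_morN (ml_mr_tri e' i)).
by exists (WeightDataMor lrP (fun i =>
  is_tri_morD (mM_tri e i) (is_tri_morN (mM_tri e' i)))).
Qed.

End Additive.
End WeightDataMorphisms.

Lemma transport_idm (C : preadditive) (X : int -> C) (i : int) (e : i = i) :
  transport X e = idm (X i).
Proof. by rewrite (Prop_irrelevance e erefl). Qed.

(** * The functor given by zeroth homology of the weight complex *)

Section PureFunctors.
Variables (C : triangulated) (w : weight_structure C) (A : abelian).
Implicit Types (F G : additive_functor (heart w) A) (M N P : C).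

Lemma weight_complex_d0 M (D : weight_data w M) :
  cd (weight_complex D) 0 = wM_boundary D (1 - 1).
Proof.
rewrite /= /weight_complex_d.
have -> : transport (wM D) (opp_succ 0) = idm _ by exact: transport_idm.
have -> X : shift_succ 0 X = idm _.
  exact: (transport_idm (fun i => shift i X) (shift_succ_pos 0)).
by rewrite fmap1 !mcomp_idl.
Qed.

(** Here the identification [shift_succ (- 1)] is the unit [sh_unit], and the general results apply
    with [k = 1]. *)
Lemma weight_complex_dN1 M (D : weight_data w M) :
  cd (weight_complex D) (- 1) = wM_boundaryV D 1.
Proof.
rewrite /= /weight_complex_d.
have -> : transport (wM D) (opp_succ (- 1)) = idm _ by exact: transport_idm.
have -> X : shift_succ (- 1) X = shVsh X.
  rewrite -[RHS]mcomp_idl -[in RHS](mcomp_idl (shVsh X)); congr (_ \oc _).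
  exact: (transport_idm (fun i => shift i X) (shift_succ_neg 0)).
by rewrite fmap1 mcomp_idl.
Qed.

(** Two extensions differ by an extension of 0; its weak homotopy survives any additive functor. *)
Lemma pure_mor_unique F M N (g : Hom M N) (D : weight_data w M)
    (D' : weight_data w N) (e e' : weight_data_mor g D D') :
  pure_mor F e = pure_mor F e'.
Proof.
have [d dE] := weight_data_sub e e'; have [z0 [s0 zs]] := mM_weak_homotopy d 1.
pose z : @Hom (heart w) (weight_complex D (0 + 1)) (weight_complex D' 0) := z0.
pose s : @Hom (heart w) (weight_complex D 0) (weight_complex D' (- 1)) := s0.
have E : cm (weight_complex_mor e) 0 = cm (weight_complex_mor e') 0 +
    (z \oc cd (weight_complex D) 0 +
     (cd (weight_complex D') (- 1) : @Hom (heart w) _ (weight_complex D' 0))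
       \oc s).
  rewrite weight_complex_d0 weight_complex_dN1.
  have : mM e (1 - 1) = mM e' (1 - 1) + mM d (1 - 1).
    by rewrite dE [RHS]addrC [RHS]subrK.
  by rewrite zs.
pose K := map_complex F (weight_complex D).
pose L := map_complex F (weight_complex D').
pose Fz : Hom (K (0 + 1)) (L 0) := fmap F z.
pose Fs : Hom (K 0) (L (- 1)) := fmap F s.
apply: (@H0_map_homotopic _ _ _ _ _ Fz Fs).
by rewrite -!fmapM -!fmapD -E.
Qed.

Lemma pure_mapE F M N (g : Hom M N) (D : weight_data w M)
    (D' : weight_data w N) (e : weight_data_mor g D D') :
  pure_map F D D' g = pure_mor F e.
Proof. exact: pure_mor_unique. Qed.

Lemma pure_map_idm F M (D : weight_data w M) :
  pure_map F D D (idm M) = idm (pure_obj F D).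
Proof.
rewrite (pure_mapE F (weight_data_idm D)).
by apply: H0_map_idm; exact: (fmap1 F (weight_complex D 0)).
Qed.

Lemma pure_map_comp F M N P (g : Hom N P) (f : Hom M N) (D : weight_data w M)
    (D' : weight_data w N) (D'' : weight_data w P) :
  pure_map F D D'' (g \oc f) = pure_map F D' D'' g \oc pure_map F D D' f.
Proof.
have [e _] := weight_data_mor_exists f D D'.
have [e' _] := weight_data_mor_exists g D' D''.
rewrite (pure_mapE F e) (pure_mapE F e') (pure_mapE F (weight_data_comp e' e)).
apply: H0_map_comp; exact: (fmapM F (cm (weight_complex_mor e') 0)
  (cm (weight_complex_mor e) 0)).
Qed.

Lemma pure_mapD F M N (f g : Hom M N) (D : weight_data w M)
    (D' : weight_data w N) :
  pure_map F D D' (f + g) = pure_map F D D' f + pure_map F D D' g.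
Proof.
have [e _] := weight_data_mor_exists f D D'.
have [e' _] := weight_data_mor_exists g D D'.
rewrite (pure_mapE F e) (pure_mapE F e') (pure_mapE F (weight_data_add e e')).
apply: H0_mapD; exact: (fmapD F (cm (weight_complex_mor e) 0)
  (cm (weight_complex_mor e') 0)).
Qed.

Lemma pure_map0 F M N (D : weight_data w M) (D' : weight_data w N) :
  pure_map F D D' 0 = 0.
Proof.
by apply: (addrI (pure_map F D D' 0)); rewrite -pure_mapD !addr0.
Qed.

Lemma pure_map_iso F M (D D' : weight_data w M) :
  is_iso (pure_map F D D' (idm M)).
Proof.
exists (pure_map F D' D (idm M)).
by rewrite -!pure_map_comp mcomp_idl !pure_map_idm.
Qed.

Lemma pure_map_exact_at F (X Y Z : C) (f : Hom X Y) (g : Hom Y Z)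
    (h : Hom Z (sh X)) (DX : weight_data w X) (DZ : weight_data w Z) :
  dist f g h -> exists DY : weight_data w Y,
  forall W (y : Hom W (pure_obj F DY)), pure_map F DY DZ g \oc y = 0 ->
  exists (P : A) (q : Hom P W) (x : Hom P (pure_obj F DX)),
    is_epi q /\ pure_map F DX DY f \oc x = y \oc q.
Proof.
move=> dfgh.
have [DY [ef [eg [s [r [t [r' [t' [p [e1 e2 e3]]]]]]]]]] :=
  exact_weight_data DX DZ 1 dfgh.
exists DY; rewrite (pure_mapE F ef) (pure_mapE F eg).
pose KX := weight_complex DX; pose KY := weight_complex DY.
pose KZ := weight_complex DZ.
pose u := weight_complex_mor ef; pose v := weight_complex_mor eg.
pose dY : Hom (KY (- 1)) (KY 0) := cd KY (- 1).
pose dZ : Hom (KZ (- 1)) (KZ 0) := cd KZ (- 1).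
(* The three identities are restated in the heart so that [F] can be applied. *)
have {}e1 : idm (KY 0) = (s : Hom (KZ 0) (KY 0)) \oc cm v 0 +
    cm u 0 \oc (r : Hom (KY 0) (KX 0)) + dY \oc (t : Hom (KY 0) (KY (- 1))).
  by rewrite /dY weight_complex_dN1; exact: e1.
have {}e2 : (s : Hom (KZ 0) (KY 0)) \oc dZ =
    cm u 0 \oc (r' : Hom (KZ (- 1)) (KX 0)) +
    dY \oc (t' : Hom (KZ (- 1)) (KY (- 1))).
  by rewrite /dY /dZ !weight_complex_dN1; exact: e2.
have {}e3 : (p : Hom (KY (0 + 1)) (KX (0 + 1))) \oc cm u (0 + 1) \oc cd KX 0 =
    cd KX 0.
  by rewrite weight_complex_d0; exact: e3.
move=> W y; apply: (@homology_map_exact A _ _ _ _ _ _ _ _ _ _ _ _ _ _ _ _ _ _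
  _ _ _ _ _ _ _ _ _ _ (fmap F (s : Hom (KZ 0) (KY 0)))
  (fmap F (r : Hom (KY 0) (KX 0))) (fmap F (t : Hom (KY 0) (KY (- 1))))
  (fmap F (r' : Hom (KZ (- 1)) (KX 0)))
  (fmap F (t' : Hom (KZ (- 1)) (KY (- 1))))
  (fmap F (p : Hom (KY (0 + 1)) (KX (0 + 1))))).
- by have := congr1 (fmap F) e1; rewrite fmap1 !fmapD !fmapM.
- by have := congr1 (fmap F) e2; rewrite fmapD !fmapM.
- by have := congr1 (fmap F) e3; rewrite !fmapM.
Qed.

Lemma pure_map_exact F (X Y Z : C) (f : Hom X Y) (g : Hom Y Z)
    (h : Hom Z (sh X)) (DX : weight_data w X) (DY : weight_data w Y)
    (DZ : weight_data w Z) :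
  dist f g h -> is_exact (pure_map F DX DY f) (pure_map F DY DZ g).
Proof.
move=> dfgh; apply: is_exactP.
  by rewrite -pure_map_comp (dist_comp0 dfgh) pure_map0.
move=> W y gy; have [D ex] := pure_map_exact_at F DX DZ dfgh.
(* Move [y] to the special data [D] of Y by the comparison isomorphism, and come back at the end. *)
have [|P [q [x [qE xE]]]] := ex _ (pure_map F DY D (idm Y) \oc y).
  by rewrite mcompA -pure_map_comp mcomp_idr.
exists P, q, x; split=> //.
rewrite -[f]mcomp_idl (pure_map_comp F (idm Y) f DX D DY) -mcompA xE.
by rewrite !mcompA -pure_map_comp mcomp_idl pure_map_idm mcomp_idl.
Qed.

(** Both composites have the same degree 0 component. As [D] and [D'] are arbitrary, the case of an
    identity gives compatibility with the comparison maps. *)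
Lemma pure_nat_natural F G (phi : nat_trans F G) M N (g : Hom M N)
    (D : weight_data w M) (D' : weight_data w N) :
  pure_nat phi D' \oc pure_map F D D' g = pure_map G D D' g \oc pure_nat phi D.
Proof.
have [e _] := weight_data_mor_exists g D D'; rewrite !(pure_mapE _ e).
pose u := map_complex_mor F (weight_complex_mor e).
pose n := nat_complex_mor phi (weight_complex D').
have cE p : cm n (p + 1) \oc cm u (p + 1) \oc cd _ p =
    cd _ p \oc (cm n p \oc cm u p).
  by rewrite -mcompA cm_cd !mcompA cm_cd.
rewrite -(@H0_map_comp _ _ _ _ _ _ (ComplexMor cE)) //.
by rewrite -(@H0_map_comp _ _ _ _ _ _ (ComplexMor cE)) //; exact: nt_natural.
Qed.

Lemma pure_nat_idm F M (D : weight_data w M) :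
  pure_nat (id_nat F) D = idm (pure_obj F D).
Proof. exact: H0_map_idm. Qed.

Lemma pure_nat_comp F G K (psi : nat_trans G K) (phi : nat_trans F G) M
    (D : weight_data w M) :
  pure_nat (comp_nat psi phi) D = pure_nat psi D \oc pure_nat phi D.
Proof. exact: H0_map_comp. Qed.

End PureFunctors.

Theorem proposition2p3p1 (C : triangulated) (w : weight_structure C) (A : abelian) :
  (* the maps on homology do not depend on the chosen extensions *)
  (forall (F : additive_functor (heart w) A) (M M' : C)
     (D : weight_data w M) (D' : weight_data w M') (g : Hom M M')
     (e : weight_data_mor g D D'),
     pure_mor F e = pure_map F D D' g) /\
  (* H is a homological functor *)
  (forall (F : additive_functor (heart w) A) (t : forall M : C, weight_data w M),
     is_homological (H_map t F)) /\
  (* H does not depend on the choices of weight complexes *)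
  (forall (F : additive_functor (heart w) A)
     (t t' : forall M : C, weight_data w M),
     is_natural (H_map t F) (H_map t' F) (H_comparison F t t') /\
     (forall M : C, is_iso (H_comparison F t t' M))) /\
  (* H is natural in the functor F *)
  (forall t : forall M : C, weight_data w M,
     (forall (F G : additive_functor (heart w) A) (phi : nat_trans F G),
        is_natural (H_map t F) (H_map t G) (H_nat t phi)) /\
     (forall (F : additive_functor (heart w) A) (M : C),
        H_nat t (id_nat F) M = idm (H_obj t F M)) /\
     (forall (F G K : additive_functor (heart w) A)
        (psi : nat_trans G K) (phi : nat_trans F G) (M : C),
        H_nat t (comp_nat psi phi) M = mcomp (H_nat t psi M) (H_nat t phi M)) /\
     (forall (F G : additive_functor (heart w) A) (phi : nat_trans F G)
        (t' : forall M : C, weight_data w M) (M : C),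
        mcomp (H_nat t' phi M) (H_comparison F t t' M) =
        mcomp (H_comparison G t t' M) (H_nat t phi M))).
Proof.
split=> [F M M' D D' g e|]; first exact/esym/pure_mapE.
split=> [F t|].
  split=> [|X Y f g|X Y Z f g h].
  - split=> [X|X Y Z g f]; first exact: pure_map_idm.
    exact: pure_map_comp.
  - exact: pure_mapD.
  - exact: pure_map_exact.
split=> [F t t'|t].
  split=> [X Y f|M]; last exact: pure_map_iso.
  by rewrite /H_map /H_comparison -!pure_map_comp mcomp_idl mcomp_idr.
split=> [F G phi X Y f|]; first exact: pure_nat_natural.
split=> [F M|]; first exact: pure_nat_idm.
split=> [F G K psi phi M|F G phi t' M]; first exact: pure_nat_comp.
exact: pure_nat_natural.
Qed.
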